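(* Let $F|K$ be an algebraic function field. The prime divisors of $F|K$ lie dense in $S(F|K)$ with respect to the patch topology.
   Context: An algebraic function field $F|K$ is a finitely generated field extension of transcendence degree at least $1$; the characteristic is arbitrary. $S(F|K)$ (the Zariski space) is the set of all places $P$ of $F$ whose restriction to $K$ is the identity, up to equivalence; equivalently, the set of all valuation rings of $F$ containing $K$. $\mathcal O_P$ is the valuation ring of $P$, $\mathcal M_P$ its maximal ideal, $FP$ its residue field. The patch topology on $S(F|K)$ has as basic open sets the sets $\{P\in S(F|K)\mid a_1,\ldots,a_k\in\mathcal O_P;\ b_1,\ldots,b_\ell\in\mathcal M_P\}$ with $k,\ell\ge0$ and $a_i,b_j\in F$. A prime divisor of $F|K$ is a place $P\in S(F|K)$ with $\operatorname{trdeg}(FP|K)=\operatorname{trdeg}(F|K)-1$. *)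

(* Defs.v *)
From HB Require Import structures.
From mathcomp Require Import all_boot all_order all_algebra.
From mathcomp Require Import generic_quotient ring_quotient mpoly.
From mathcomp Require Import boolp classical_sets topology_structure.

Set Implicit Arguments.
Unset Strict Implicit.
Unset Printing Implicit Defensive.

Import GRing.Theory.
Local Open Scope ring_scope.
Local Open Scope classical_set_scope.
Local Open Scope quotient_scope.

(* A field extension F|K is given by a ring morphism iota : K -> F. *)
Section Extension.
Context {K F : fieldType} (iota : {rmorphism K -> F}).

(* K(X) *)
Definition subfield_gen (X : set F) : set F :=
  smallest (fun L : set F => divring_closed (mem L)) (range iota `|` X).

Definition finitely_generated :=
  exists (n : nat) (x : 'I_n -> F), subfield_gen (range x) = [set: F].

Definition alg_independent (n : nat) (x : 'I_n -> F) :=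
  forall p : {mpoly K[n]}, mmap iota x p = 0 -> p = 0.

Definition algebraic_over (L : set F) (y : F) :=
  exists p : {poly F}, [/\ p != 0, p \is a polyOver (mem L) & root p y].

Definition transcendence_basis (n : nat) (x : 'I_n -> F) :=
  alg_independent x /\ forall y, algebraic_over (subfield_gen (range x)) y.

(* trdeg(F|K) = n; the cardinality of a transcendence basis being an invariant
   of F|K, at most one n qualifies. *)
Definition has_trdeg (n : nat) :=
  exists x : 'I_n -> F, transcendence_basis x.

Definition algebraic_function_field :=
  finitely_generated /\ exists2 d : nat, (1 <= d)%N & has_trdeg d.

(* A place that is the identity on K, up to equivalence, is given by its
   valuation ring; the trivial place, with valuation ring F, is included. *)
Record zariski_space := ZariskiPoint {
  val_ring : {pred F};
  val_ring_subring : subring_closed val_ring;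
  val_ring_total : forall x, x != 0 -> (x \in val_ring) || (x^-1 \in val_ring);
  val_ringK : forall c, iota c \in val_ring }.

Lemma zariski_space_ext (P Q : zariski_space) :
  val_ring P =i val_ring Q -> P = Q.
Proof.
case: P Q => [A A1 A2 A3] [B B1 B2 B3] /= eqAB.
have {}eqAB : A = B by apply/funext => x; exact: eqAB.
by case: B / eqAB B1 B2 B3 => *; congr ZariskiPoint; exact: Prop_irrelevance.
Qed.

(* The non-units of the valuation ring; 0 is listed apart because 0^-1 = 0. *)
Definition val_ideal (P : zariski_space) : {pred F} :=
  [pred x | (x \in val_ring P) && ((x == 0) || (x^-1 \notin val_ring P))].

HB.instance Definition _ (P : zariski_space) :=
  GRing.isSubringClosed.Build F (val_ring P) (val_ring_subring P).

Record val_ring_type (P : zariski_space) :=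
  ValRingElem { val_ring_val : F; val_ring_valP : val_ring_val \in val_ring P }.

HB.instance Definition _ (P : zariski_space) :=
  [isSub for @val_ring_val P].
HB.instance Definition _ (P : zariski_space) :=
  [Choice of val_ring_type P by <:].
HB.instance Definition _ (P : zariski_space) :=
  [SubChoice_isSubComNzRing of val_ring_type P by <:].

Definition max_ideal (P : zariski_space) : {pred val_ring_type P} :=
  [pred u | val u \in val_ideal P].
Arguments max_ideal : clear implicits.

Lemma val_idealM (P : zariski_space) a x :
  a \in val_ring P -> x \in val_ideal P -> a * x \in val_ideal P.
Proof.
move=> aO; rewrite !inE => /andP[xO xM]; rewrite rpredM //= mulf_eq0.
have [//|a0 /=] := eqVneq a 0; case/orP: xM => [->//|xV].
apply/orP; right; apply: contra xV => axV.
by rewrite -(mulKf a0 x) invfM invrK rpredM.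
Qed.

Lemma val_idealD (P : zariski_space) x y :
  x \in val_ideal P -> y \in val_ideal P -> x + y \in val_ideal P.
Proof.
have [->|x0] := eqVneq x 0; first by rewrite add0r.
have [->|y0] := eqVneq y 0; first by rewrite addr0.
move=> xM yM; have xy0 : x / y != 0 by rewrite mulf_neq0 ?invr_eq0.
case/orP: (val_ring_total P xy0) => xyO.
  have -> : x + y = (x / y + 1) * y by rewrite mulrDl mul1r divfK.
  by apply: val_idealM => //; rewrite rpredD ?rpred1.
have -> : x + y = (1 + (x / y)^-1) * x by rewrite invf_div mulrDl mul1r divfK.
by apply: val_idealM => //; rewrite rpredD ?rpred1.
Qed.

Lemma max_ideal_closed (P : zariski_space) : idealr_closed (max_ideal P).
Proof.
split; first by rewrite !inE /= rpred0 eqxx.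
  by rewrite !inE /= rpred1 oner_eq0 invr1 rpred1.
move=> a u v uM vM; rewrite inE; apply: val_idealD => //.
by apply: val_idealM => //; exact: valP.
Qed.

HB.instance Definition _ (P : zariski_space) :=
  isIdealr.Build (val_ring_type P) (max_ideal P) (@max_ideal_closed P).

Definition residue_field (P : zariski_space) : Type :=
  {ideal_quot (max_ideal P)}.

HB.instance Definition _ (P : zariski_space) :=
  GRing.ComNzRing.on (residue_field P).

Definition residue (P : zariski_space) (u : val_ring_type P) :
  residue_field P := \pi_({ideal_quot (max_ideal P)}) u.

Definition residue_inv (P : zariski_space) (a : residue_field P) :
    residue_field P :=
  residue (insubd (0 : val_ring_type P) (val (repr a))^-1).

Lemma residue_eq0 (P : zariski_space) (u : val_ring_type P) :
  (residue u == 0) = (val u \in val_ideal P).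
Proof.
have -> : 0 = residue (0 : val_ring_type P) by rewrite /residue rmorph0.
by rewrite /residue -Quotient.idealrBE subr0.
Qed.

Lemma residue_mulVf (P : zariski_space) (a : residue_field P) :
  a != 0 -> residue_inv a * a = 1.
Proof.
have ra : residue (repr a) = a by exact: reprK.
rewrite -{1}ra residue_eq0 inE /= val_ring_valP /= negb_or negbK => /andP[a0 aV].
rewrite -{2}ra /residue_inv -[RHS](rmorph1 \pi_({ideal_quot (max_ideal P)})).
rewrite -[LHS]rmorphM; congr \pi; apply: val_inj.
by rewrite /= val_insubd aV mulVf.
Qed.

Lemma residue_inv0 (P : zariski_space) :
  residue_inv (0 : residue_field P) = 0.
Proof.
have : residue (repr (0 : residue_field P)) == 0 by apply/eqP; exact: reprK.
rewrite residue_eq0 inE /= val_ring_valP /= /residue_inv => /orP[/eqP r0|rV].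
  by apply/eqP; rewrite residue_eq0 /= r0 invr0 val_insubd if_same inE rpred0 eqxx.
by apply/eqP; rewrite residue_eq0 val_insubd (negPf rV) inE rpred0 eqxx.
Qed.

HB.instance Definition _ (P : zariski_space) :=
  GRing.ComNzRing_isField.Build (residue_field P)
    (@residue_mulVf P) (@residue_inv0 P).

Definition residue_emb (P : zariski_space) (c : K) : residue_field P :=
  residue (ValRingElem (val_ringK P c)).

Lemma residue_emb_zmod (P : zariski_space) : zmod_morphism (residue_emb P).
Proof.
move=> c d; rewrite /residue_emb /residue -rmorphB; congr \pi.
by apply: val_inj; rewrite /= rmorphB.
Qed.

Lemma residue_emb_monoid (P : zariski_space) : monoid_morphism (residue_emb P).
Proof.
split=> [|c d].
  rewrite /residue_emb /residue -[RHS](rmorph1 \pi_({ideal_quot (max_ideal P)})).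
  by congr \pi; apply: val_inj; rewrite /= rmorph1.
rewrite /residue_emb /residue -[RHS]rmorphM; congr \pi.
by apply: val_inj; rewrite /= rmorphM.
Qed.

HB.instance Definition _ (P : zariski_space) :=
  GRing.isZmodMorphism.Build K (residue_field P) (residue_emb P)
    (residue_emb_zmod P).
HB.instance Definition _ (P : zariski_space) :=
  GRing.isMonoidMorphism.Build K (residue_field P) (residue_emb P)
    (residue_emb_monoid P).

Definition patch_basic (a b : seq F) : set zariski_space :=
  [set P | {subset a <= val_ring P} /\ {subset b <= val_ideal P}].

Definition patch_base : set (set zariski_space) :=
  [set U | exists a b : seq F, U = patch_basic a b].

Lemma patch_base_cover : \bigcup_(U in patch_base) U = [set: zariski_space].
Proof.
apply/seteqP; split=> // P _; exists (patch_basic [::] [::]) => //.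
by exists [::], [::].
Qed.

Lemma patch_base_join (U V : set zariski_space) (P : zariski_space) :
  patch_base U -> patch_base V -> U P -> V P ->
  exists W, [/\ patch_base W, W P & W `<=` U `&` V].
Proof.
move=> [a [b ->]] [a' [b' ->]] [Pa Pb] [Pa' Pb'].
exists (patch_basic (a ++ a') (b ++ b')); split.
- by exists (a ++ a'), (b ++ b').
- by split=> x; rewrite mem_cat => /orP[]; auto.
- move=> Q [Qa Qb]; split; split=> x xs; (apply: Qa || apply: Qb);
  by rewrite mem_cat xs ?orbT.
Qed.

HB.instance Definition _ := gen_eqMixin zariski_space.
HB.instance Definition _ := gen_choiceMixin zariski_space.
HB.instance Definition _ := @isBaseTopological.Build zariski_space
  (set zariski_space) patch_base id patch_base_cover patch_base_join.

End Extension.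

Definition prime_divisor (K F : fieldType) (iota : {rmorphism K -> F})
    (P : zariski_space iota) :=
  exists d : nat, has_trdeg iota d.+1 /\ has_trdeg (residue_emb P) d.

(* Main.v *)
From HB Require Import structures.
Require Import Defs.
From mathcomp Require Import all_boot all_algebra.
From mathcomp Require Import generic_quotient ring_quotient mpoly.
From mathcomp Require Import boolp classical_sets topology_structure.

Set Implicit Arguments.
Unset Strict Implicit.
Unset Printing Implicit Defensive.

(** Let P be a place in a basic open set. Since O_P is a valuation ring, one of
    the finitely many elements required to lie in the maximal ideal, say b,
    divides all the others, so the task is to find a prime divisor Q finite on
    a finite list of elements of O_P (the required ones, b, the quotients by b
    and generators of F or their inverses) and with b in its maximal ideal.

    By Noether normalization ([noether_normalization]) there are algebraically
    independent t_1, ..., t_m such that a place is finite on the list exactly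
    when it is finite on all t_i; they form a transcendence basis of F. Suppose
    that b is nonzero. Let c be the constant coefficient of its minimal
    polynomial over K(t_1, ..., t_m), which is its norm up to sign. As b is
    integral over K[t_1, ..., t_m], so is c, and c lies in the maximal ideal of
    P; hence c is not in K and, for some i, is transcendental over the field
    E = K(t_j, j <> i) ([exists_transcendental_over_others]). Then c has a zero
    at a place above E that is finite at t_i ([finite_zero_or_pole]). As the
    minimal polynomial has integral coefficients there and c is its constant
    coefficient, b is not a unit over the valuation ring, so it has a zero at
    some place Q above ([lift_place], [place_over_others]). If b is zero, i can
    be chosen at will, with Q any place above E that has t_i in its maximal
    ideal.

    Such a Q is a prime divisor ([residue_trdeg]): its valuation ring contains
    E, so the residues of the t_j with j <> i are algebraically independent, and
    every residue is algebraic over them because F has transcendence degree 1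
    over E while Q is not trivial.

    Places are constructed throughout by one existence theorem
    ([place_of_nonunit]): a subring maximal among those that avoid an element
    but contain its inverse is a valuation ring. It makes places test objects:
    integrality over a ring and algebraicity over a subfield are decided by the
    valuation rings above it, which gives the closure properties of algebraic
    elements, and lets Noether normalization be phrased without equations of
    integrality. *)

Import GRing.Theory.
Local Open Scope ring_scope.
Local Open Scope classical_set_scope.
Local Open Scope quotient_scope.

(** * Subrings, adjunction and division *)

Section PolyOver.
Context {F : fieldType}.
Implicit Types (A : subringClosed F) (E : divringClosed F) (x y z : F).

Definition subring_of (S : {pred F}) (clS : subring_closed S) :
  subringClosed F := HB.pack S (GRing.isSubringClosed.Build F S clS).

Definition subfield_of (S : {pred F}) (clS : divring_closed S) :
  divringClosed F := HB.pack S (GRing.isDivringClosed.Build F S clS).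

Definition algebraic (E : {pred F}) (y : F) :=
  exists p : {poly F}, [/\ p != 0, p \is a polyOver E & root p y].

Definition integral (A : {pred F}) (y : F) :=
  exists p : {poly F}, [/\ p \is monic, p \is a polyOver A & root p y].

Definition adjoin (A : {pred F}) (x : F) : {pred F} :=
  [pred y | `[< exists2 p : {poly F}, p \is a polyOver A & y = p.[x] >]].

Lemma adjoinP A x y :
  reflect (exists2 p : {poly F}, p \is a polyOver A & y = p.[x])
          (y \in adjoin A x).
Proof. exact: asboolP. Qed.

Lemma adjoin_closed A x : subring_closed (adjoin A x).
Proof.
split=> [|_ _ /adjoinP[p pA ->] /adjoinP[q qA ->]
         |_ _ /adjoinP[p pA ->] /adjoinP[q qA ->]]; apply/adjoinP.
- by exists 1; rewrite ?rpred1 ?hornerC.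
- by exists (p - q); rewrite ?rpredB // hornerD hornerN.
- by exists (p * q); rewrite ?rpredM // hornerM.
Qed.

HB.instance Definition _ A x :=
  GRing.isSubringClosed.Build F (adjoin A x) (adjoin_closed A x).

Lemma adjoin_sub A x : {subset A <= adjoin A x}.
Proof.
by move=> y yA; apply/adjoinP; exists y%:P; rewrite ?polyOverC ?hornerC.
Qed.

Lemma mem_adjoin A x : x \in adjoin A x.
Proof. by apply/adjoinP; exists 'X; rewrite ?polyOverX ?hornerX. Qed.

Lemma polyOver_sub (S T : {pred F}) (p : {poly F}) :
  {subset S <= T} -> p \is a polyOver S -> p \is a polyOver T.
Proof. by move=> sST /(all_nthP 0) pS; apply/(all_nthP 0) => i /pS/sST. Qed.

Lemma sub_adjoin A (B : subringClosed F) x :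
  {subset A <= B} -> x \in B -> {subset adjoin A x <= B}.
Proof.
move=> AB xB _ /adjoinP[p pA ->]; apply: rpred_horner => //.
exact: polyOver_sub AB _.
Qed.

(** If z = p(1/z) and p has at most n coefficients, then z ^ n is equal to
    z ^ (n - 1) p(1/z), a polynomial in z of degree less than n. *)
Lemma integral_adjoinV A z : z != 0 -> z \in adjoin A z^-1 -> integral A z.
Proof.
move=> z0 /adjoinP[p pA zE].
have p0 : p != 0 by apply: contra_neq z0 => p0; rewrite zE p0 horner0.
pose n := size p; pose q := \poly_(i < n) p`_(n.-1 - i).
have n0 : (0 < n)%N by rewrite size_poly_gt0.
exists ('X^n - q); split.
- rewrite monicE lead_coefDl ?lead_coefXn //.
  by rewrite size_polyXn size_polyN ltnS size_poly.
- rewrite rpredB ?polyOverXn //.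
  by apply: polyOver_poly => i _; apply: (polyOverP pA).
rewrite /root hornerD hornerN hornerXn horner_poly (reindex_inj rev_ord_inj) /=.
rewrite -(prednK n0) exprS {1}zE horner_coef mulr_suml prednK // subr_eq0.
apply/eqP/eq_bigr => i _; have le_in : (i <= n.-1)%N by rewrite -ltnS prednK.
rewrite (_ : n - i.+1 = n.-1 - i)%N; last by rewrite -subn1 -subnDA add1n.
rewrite subKn // -mulrA; congr (_ * _).
by rewrite -{1}(subnKC le_in) exprD mulrA -exprMn mulVf // expr1n mul1r.
Qed.

Lemma division A (p f : {poly F}) :
  p \is a polyOver A -> f \is a polyOver A -> f \is monic ->
  exists q r : {poly F}, [/\ q \is a polyOver A, r \is a polyOver A,
    p = q * f + r & (size r < size f)%N].
Proof.
move=> pA fA fm; have [n le_pn] := ubnP (size p).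
elim: n => // n IHn in p pA le_pn *.
have [lt_pf|le_fp] := ltnP (size p) (size f).
  by exists 0, p; rewrite rpred0 mul0r add0r.
have f0 : (0 < size f)%N by rewrite size_poly_gt0 monic_neq0.
have p0 : (0 < size p)%N by apply: leq_trans le_fp.
pose h : {poly F} := lead_coef p *: 'X^(size p - size f).
have hA : h \is a polyOver A.
  by rewrite polyOverZ ?polyOverXn //; apply: (polyOverP pA).
have sz : (size (p - h * f)%R < size p)%N.
  rewrite -(prednK p0) ltnS; apply/leq_sizeP => j le_j.
  rewrite coefB /h -scalerAl coefZ coefXnM.
  have -> : (j < size p - size f)%N = false.
    by apply/negbTE; rewrite -leqNgt (leq_trans _ le_j) // -subn1 leq_sub2l.
  move: le_j; rewrite leq_eqVlt => /predU1P[<-|lt_j].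
    have -> : ((size p).-1 - (size p - size f) = (size f).-1)%N.
      by rewrite -!subn1 subnAC subKn.
    by rewrite -!lead_coefE (monicP fm) mulr1 subrr.
  rewrite prednK // in lt_j.
  rewrite !nth_default ?mulr0 ?subr0 //.
  by rewrite leq_subRL ?(leq_trans _ lt_j) ?leq_subr // subnK.
have [|q [r [qA rA pE sr]]] := IHn _ _ (leq_trans sz le_pn).
  by rewrite rpredB ?rpredM.
exists (q + h), r; split=> //; first by rewrite rpredD.
by rewrite mulrDl addrAC -pE subrK.
Qed.

End PolyOver.

(** * Maximal subrings avoiding an element *)

Section MaximalSubring.
Context {F : fieldType}.
Implicit Types (A B C : subringClosed F) (x y z : F).

Lemma maximal_subring A z : z \notin A ->
  exists B : subringClosed F, [/\ {subset A <= B}, z \notin B &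
    forall C, {subset B <= C} -> z \notin C -> {subset C <= B}].
Proof.
move=> zA.
(* The union of the empty chain is empty, hence the first alternative. *)
pose good (X : set F) := X = set0 \/
  [/\ subring_closed (mem X), {subset A <= X} & z \notin X].
have [|X [gX Xmax]] := @Zorn_bigcup F good.
  move=> T goodT totT.
  have [[Y [TY Y0]]|noY] := pselect (exists Y, T Y /\ Y <> set0); last first.
    left; apply/seteqP; split=> // x [Y TY Yx]; apply: noY; exists Y.
    by split=> // Y0; rewrite Y0 in Yx.
  have goodY Z x : T Z -> Z x ->
      [/\ subring_closed (mem Z), {subset A <= Z} & z \notin Z].
    by move=> TZ Zx; case: (goodT _ TZ) => // Z0; rewrite Z0 in Zx.
  have {Y0} [y Yy] : exists y, Y y by apply/set0P/eqP.
  have [clY AY _] := goodY _ _ TY Yy.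
  have common x x' : x \in \bigcup_(Z in T) Z -> x' \in \bigcup_(Z in T) Z ->
      exists Z, [/\ T Z, subring_closed (mem Z), x \in Z & x' \in Z].
    rewrite !inE => -[Z TZ Zx] [Z' TZ' Zx'].
    have [clZ _ _] := goodY _ _ TZ Zx; have [clZ' _ _] := goodY _ _ TZ' Zx'.
    case: (totT _ _ TZ TZ') => sZ; [exists Z'|exists Z];
      by split=> //; rewrite inE //; apply: sZ.
  right; split=> [|a aA|].
  - split=> [|x x' Ux Ux'|x x' Ux Ux'].
    + by apply: mem_set; exists Y => //; case: clY => /set_mem.
    + have [Z [TZ [_ clZ _] Zx Zx']] := common _ _ Ux Ux'.
      by apply: mem_set; exists Z => //; exact/set_mem/clZ.
    + have [Z [TZ [_ _ clZ] Zx Zx']] := common _ _ Ux Ux'.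
      by apply: mem_set; exists Z => //; exact/set_mem/clZ.
  - by apply: mem_set; exists Y => //; exact/set_mem/AY.
  - apply/negP => /set_mem[Z TZ Zz].
    by have [_ _ /negP] := goodY _ _ TZ Zz; apply; exact: mem_set.
have goodC C : {subset A <= C} -> z \notin C -> good [set x | x \in C].
  move=> AC zC; right; split; last by apply/negP => /set_mem; exact/negP.
    split=> [|x y /set_mem xC /set_mem yC|x y /set_mem xC /set_mem yC];
      apply: mem_set; by [exact: rpred1|exact: rpredB|exact: rpredM].
  by move=> a aA; apply: mem_set; exact: AC.
case: gX => [X0|[clX AX zX]].
  case: (Xmax [set x | x \in A]); last exact: goodC.
  by rewrite X0; split=> // /(_ 1); apply; exact: rpred1.
exists (subring_of clX); split=> // C XC zC x xC; apply: contrapT => xX.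
apply: (Xmax [set y | y \in C]).
  split=> [y Xy /=|sCX]; first by apply: XC; exact: mem_set.
  by apply: xX; apply: mem_set; exact: sCX.
by apply: goodC => // a aA; apply: XC; exact: AX.
Qed.

Section Maximal.
Variables (B : subringClosed F) (z : F).
Hypotheses (zVB : z^-1 \in B) (zB : z \notin B).
Hypothesis Bmax : forall C, {subset B <= C} -> z \notin C -> {subset C <= B}.

Let mem_adjoin_z x : x \notin B -> z \in adjoin B x.
Proof.
move=> xB; apply: contraNT xB => zBx.
by apply: (Bmax (C := subring_of (adjoin_closed B x)));
  [exact: adjoin_sub| |exact: mem_adjoin].
Qed.

Let z0 : z != 0. Proof. by apply: contraNneq zB => ->; rewrite rpred0. Qed.

(** 1/z lies in the Jacobson radical of B: by maximality it is enough that z is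
    not in B[1/u] for u = 1 - c/z, and if z u ^ k were in B then so would be z,
    because 1 - u ^ k is a multiple of 1/z in B. *)
Let unit_sub1 c : c \in B -> (1 - z^-1 * c)^-1 \in B.
Proof.
move=> cB; set u := 1 - z^-1 * c; apply: contraNT (zB) => /mem_adjoin_z.
have uB : u \in B by rewrite rpredB ?rpred1 ?rpredM.
have [-> |u0] := eqVneq u 0.
  by rewrite invr0; apply: sub_adjoin; rewrite ?rpred0.
case/adjoinP=> p pB zE.
have key k : z * (1 - u ^+ k) \in B.
  elim: k => [|k IHk]; first by rewrite expr0 subrr mulr0 rpred0.
  rewrite (_ : _ * _ = z * (1 - u ^+ k) + z * (1 - u) * u ^+ k).
    rewrite rpredD // rpredM ?rpredX // /u opprB addrCA subrr addr0.
    by rewrite mulrA mulfV ?mul1r.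
  by rewrite -mulrA -mulrDr mulrBl mul1r -exprS addrA subrK.
have -> : z = z * (1 - u ^+ size p) + z * u ^+ size p.
  by rewrite -mulrDr subrK mulr1.
rewrite rpredD // {1}zE horner_coef mulr_suml rpred_sum // => i _.
rewrite -mulrA rpredM //; first exact: (polyOverP pB).
rewrite (_ : u ^+ size p = u ^+ (size p - i) * u ^+ i).
  by rewrite exprVn mulrCA mulVf ?expf_neq0 // mulr1 rpredX.
by rewrite -exprD subnK // ltnW.
Qed.

(** The relation q(1/x) = z, divided by z, expresses 1 through negative powers
    of x, and so rewrites the top term of p(x). *)
Let lower_degree x (p q : {poly F}) :
  p \is a polyOver B -> q \is a polyOver B -> z = p.[x] -> z = q.[x^-1] ->
  (0 < size q <= size p)%N -> x != 0 ->
  exists p', [/\ p' \is a polyOver B, z = p'.[x] & (size p' < size p)%N].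
Proof.
move=> pB qB zp zq /andP[q0 le_qp] x0.
have qBi i : q`_i \in B by apply: (polyOverP qB).
have pBi i : p`_i \in B by apply: (polyOverP pB).
have p0 : (0 < size p)%N by apply: leq_trans le_qp.
pose n := (size p).-1; pose u := 1 - z^-1 * q`_0.
have uB : u^-1 \in B by apply: unit_sub1.
have u0 : u != 0.
  apply: contraNneq zB => /eqP; rewrite subr_eq0 => /eqP u1.
  by rewrite -(mulr1 z) u1 mulVKf.
(* Here x ^ n is multiplied by the expression of 1 through powers of 1/x. *)
pose h := \poly_(i < n) (z^-1 * q`_(n - i) / u).
have hB : h \is a polyOver B.
  by apply: polyOver_poly => i _; rewrite !rpredM.
have hE : h.[x] = x ^+ n.
  have : z = q`_0 + \sum_(i < n) q`_i.+1 * x^-1 ^+ i.+1.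
    rewrite {1}zq (@horner_coef_wide _ n.+1); last by rewrite prednK.
    by rewrite big_ord_recl expr0 mulr1.
  move/(congr1 (fun w => z^-1 * w)); rewrite mulVf // mulrDr => /eqP.
  rewrite addrC -subr_eq -/u => /eqP uE.
  rewrite -[RHS]mul1r -(mulVf u0) {2}uE horner_poly.
  rewrite (reindex_inj rev_ord_inj) /=.
  rewrite mulr_sumr mulr_sumr mulr_suml; apply: eq_bigr => i _.
  have -> : x ^+ (n - i.+1) = x^-1 ^+ i.+1 * x ^+ n.
    rewrite (_ : x ^+ n = x ^+ (n - i.+1) * x ^+ i.+1).
      by rewrite exprVn mulrCA mulVf ?mulr1 // expf_neq0.
    by rewrite -exprD subnK.
  rewrite subKn // !mulrA; congr (_ * _ * _).
  by rewrite -[in RHS]mulrA [RHS]mulrC.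
exists (\poly_(i < n) p`_i + p`_n *: h); split.
- by rewrite rpredD ?polyOverZ //; apply: polyOver_poly => i _.
- rewrite hornerD hornerZ hE {1}zp horner_coef -/n -(prednK p0) big_ord_recr /=.
  by rewrite horner_poly.
rewrite -[X in (_ < X)%N](prednK p0) ltnS (leq_trans (size_polyD _ _)) //.
rewrite geq_max.
by rewrite size_poly (leq_trans (size_scale_leq _ _)) ?size_poly.
Qed.

(** If neither x nor 1/x were in B, z would be a polynomial in each of them; of
    two such expressions the longer one can always be shortened. *)
Lemma maximal_subring_total x : (x \in B) || (x^-1 \in B).
Proof.
apply/orP; apply: contrapT => /not_orP[/negP xB /negP xVB].
have x0 : x != 0 by apply: contraNneq xB => ->; rewrite rpred0.
have /adjoinP[p pB zp] := mem_adjoin_z xB.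
have /adjoinP[q qB zq] := mem_adjoin_z xVB.
have size0 (p' : {poly F}) y : z = p'.[y] -> (0 < size p')%N.
  move=> zE; rewrite size_poly_gt0; apply: contra_neq z0 => p0.
  by rewrite zE p0 horner0.
have [n] := ubnP (size p + size q).
elim: n => // n IHn in p q pB qB zp zq *; rewrite ltnS => le_n.
have [le_qp|/ltnW le_pq] := leqP (size q) (size p).
  have [|p' [p'B zp' lt_p']] := lower_degree pB qB zp zq _ x0.
    by rewrite le_qp (size0 _ _ zq).
  by apply: (IHn p' q) => //; rewrite (leq_trans _ le_n) // ltn_add2r.
have [|||q' [q'B zq' lt_q']] := @lower_degree x^-1 q p qB pB zq _ _ _.
- by rewrite invrK.
- by rewrite le_pq (size0 _ _ zp).
- by rewrite invr_eq0.
by apply: (IHn p q') => //; rewrite (leq_trans _ le_n) // ltn_add2l.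
Qed.

End Maximal.
End MaximalSubring.

(** * Places, integrality and algebraicity *)

Section Places.
Context {K F : fieldType} (iota : {rmorphism K -> F}).
Implicit Types (A : subringClosed F) (E : divringClosed F) (x y z : F).
Implicit Types (P Q : zariski_space iota) (X : set F).

Lemma val_ideal_sub P x : x \in val_ideal P -> x \in val_ring P.
Proof. by case/andP. Qed.

Lemma val_idealV P x : x != 0 -> x \in val_ideal P -> x^-1 \notin val_ring P.
Proof. by rewrite inE => /negPf-> /andP[]. Qed.

Lemma val_ring_or_ideal P x : x != 0 ->
  x \in val_ring P \/ x^-1 \in val_ideal P.
Proof.
move=> x0; have [xO|xO] := boolP (x \in val_ring P); [by left|right].
by have := val_ring_total P x0; rewrite inE invrK xO orbT (negPf xO) andbT.
Qed.

Lemma one_notin_ideal P : 1 \notin val_ideal P.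
Proof. by rewrite inE invr1 rpred1 oner_eq0. Qed.

Lemma unit_notin_ideal P x : x \in val_ring P -> x \notin val_ideal P ->
  x^-1 \in val_ring P.
Proof. by rewrite !inE => ->; rewrite negb_or negbK /= => /andP[]. Qed.

Lemma val_ideal0 P : 0 \in val_ideal P.
Proof. by rewrite inE rpred0 eqxx. Qed.

Lemma val_idealN P x : x \in val_ideal P -> - x \in val_ideal P.
Proof. by move=> xM; rewrite -mulN1r val_idealM ?rpredN ?rpred1. Qed.

Lemma val_ideal_sum P (I : Type) (r : seq I) (p : pred I) (f : I -> F) :
  (forall i, p i -> f i \in val_ideal P) ->
  \sum_(i <- r | p i) f i \in val_ideal P.
Proof.
by move=> fM; elim/big_ind: _ => //; [exact: val_ideal0|exact: val_idealD].
Qed.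

Lemma val_ideal_mulf P x y : x * y \in val_ideal P -> x \in val_ring P ->
  y \in val_ring P -> x \in val_ideal P \/ y \in val_ideal P.
Proof.
move=> xyM xO yO; have [->|x0] := eqVneq x 0; first by left; exact: val_ideal0.
have [xM|xM] := boolP (x \in val_ideal P); [by left|right].
by rewrite -(mulKf x0 y) val_idealM // unit_notin_ideal.
Qed.

Lemma subfield_ideal P E x : {subset E <= val_ring P} -> x \in E ->
  x \in val_ideal P -> x = 0.
Proof.
move=> EO xE xM; apply/eqP; apply: contraTT (xE) => x0.
by apply: contra (val_idealV x0 xM) => xE'; rewrite EO ?rpredV.
Qed.

(** A subring of F that contains A[b] and is maximal among those avoiding 1/b is
    a valuation ring. *)
Lemma place_of_nonunit A b : (forall c, iota c \in A) ->
  b^-1 \notin adjoin A b ->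
  exists P, {subset A <= val_ring P} /\ b \in val_ideal P.
Proof.
move=> KA bA; have b0 : b != 0.
  by apply: contraNneq bA => ->; rewrite invr0 adjoin_sub ?rpred0.
pose Ab := subring_of (adjoin_closed A b).
have [B [AB bB Bmax]] := maximal_subring (A := Ab) bA.
have bB' : b \in B by apply: AB; exact: mem_adjoin.
have Btot : forall x, x != 0 -> (x \in B) || (x^-1 \in B).
  by move=> x _; apply: maximal_subring_total bB Bmax x; rewrite invrK.
have KB c : iota c \in B by apply: AB; apply: adjoin_sub.
have Bcl : subring_closed B.
  by split; [exact: rpred1|exact: rpredB|exact: rpredM].
exists (ZariskiPoint Bcl Btot KB); split=> [a aA|].
  by apply: AB; exact: adjoin_sub.
by rewrite inE bB' /= (negPf b0).
Qed.

(** If y is not in O_P, dividing a monic equation of degree n by y ^ n puts 1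
    into the maximal ideal. *)
Lemma integral_val P y : integral (val_ring P) y -> y \in val_ring P.
Proof.
case=> p [pm pO /rootP py]; apply: contraT => yO.
have y0 : y != 0 by apply: contraNneq yO => ->; rewrite rpred0.
have [|yM] := val_ring_or_ideal P y0; first by rewrite (negPf yO).
case: (negP (one_notin_ideal P)).
have p0 : (0 < size p)%N by rewrite size_poly_gt0 monic_neq0.
move: py; rewrite horner_coef -(prednK p0) big_ord_recr /=.
rewrite -lead_coefE (monicP pm) mul1r => /eqP.
rewrite addrC addr_eq0 => /eqP yE.
rewrite -(@mulfV _ (y ^+ (size p).-1)) ?expf_neq0 // {1}yE mulNr val_idealN //.
rewrite mulr_suml val_ideal_sum // => i _; rewrite -mulrA val_idealM //.
  exact: (polyOverP pO).
have -> : y ^+ i / y ^+ (size p).-1 = y^-1 ^+ ((size p).-1 - i.+1) * y^-1.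
  rewrite (_ : y ^+ (size p).-1 = y ^+ ((size p).-1 - i.+1) * y * y ^+ i).
    rewrite [(_ * y ^+ i)^-1]invfM mulrCA mulfV ?expf_neq0 // mulr1.
    by rewrite invfM exprVn.
  by rewrite -mulrA -exprS -exprD subnK.
by rewrite val_idealM // rpredX // val_ideal_sub.
Qed.

(** If b is not integral over A then b is not in A[1/b], so 1/b is not a unit
    there and lies in the maximal ideal of some place. *)
Lemma integral_of_places A b : (forall c, iota c \in A) ->
  (forall P, {subset A <= val_ring P} -> b \in val_ring P) -> integral A b.
Proof.
move=> KA bO; have [->|b0] := eqVneq b 0.
  by exists 'X; rewrite monicX polyOverX rootX.
apply: integral_adjoinV => //; apply: contraT => bA.
have [|P [AP bM]] := @place_of_nonunit A b^-1 KA; first by rewrite invrK.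
have := val_idealV _ bM; rewrite invr_eq0 invrK => /(_ b0) /negP[].
exact: bO.
Qed.

Lemma algebraic_integral E y : algebraic E y -> integral E y.
Proof.
case=> p [p0 pE py]; exists ((lead_coef p)^-1 *: p); split.
- by rewrite monicE lead_coefZ mulVf ?lead_coef_eq0.
- by rewrite polyOverZ // rpredV; exact: (polyOverP pE).
by rewrite rootZ // invr_eq0 lead_coef_eq0.
Qed.

Lemma integralS (S T : {pred F}) y : {subset S <= T} ->
  integral S y -> integral T y.
Proof. by move=> sST [p [pm /(polyOver_sub sST) pS py]]; exists p. Qed.

Lemma algebraicS (S T : {pred F}) y : {subset S <= T} ->
  algebraic S y -> algebraic T y.
Proof. by move=> sST [p [pm /(polyOver_sub sST) pS py]]; exists p. Qed.

Lemma algebraic_mem E y : y \in E -> algebraic E y.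
Proof.
exists ('X - y%:P).
by rewrite polyXsubC_eq0 rpredB ?polyOverX ?polyOverC ?root_XsubC.
Qed.

Lemma algebraic_val P E y : {subset E <= val_ring P} -> algebraic E y ->
  y \in val_ring P.
Proof. by move=> EO /algebraic_integral/(integralS EO)/integral_val. Qed.

Lemma place_of_transcendental E y : (forall c, iota c \in E) ->
  ~ algebraic E y -> exists P, {subset E <= val_ring P} /\ y \in val_ideal P.
Proof.
move=> KE ytr; apply: place_of_nonunit KE _; apply/negP => /adjoinP[p pE yE].
have [y0|y0] := eqVneq y 0.
  by apply: ytr; rewrite y0; apply: algebraic_mem; rewrite rpred0.
apply: ytr; exists (p * 'X - 1); split.
- apply/eqP => /(congr1 (fun q : {poly F} => q.[0])) /eqP.
  rewrite hornerD hornerN hornerMX hornerC horner0 mulr0 sub0r.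
  by rewrite oppr_eq0 oner_eq0.
- by rewrite rpredB ?rpredM ?polyOverX ?rpred1.
- by rewrite rootE !hornerE -yE mulVf ?subrr.
Qed.

(** The right-hand side is visibly stable under sums and products, and under
    passing to the elements algebraic over E; this is how algebraic elements
    are shown to form a field and algebraicity to be transitive. *)
Lemma algebraicP E y : (forall c, iota c \in E) ->
  algebraic E y <-> (forall P, {subset E <= val_ring P} -> y \in val_ring P).
Proof.
move=> KE; split=> [yE P EP|yO]; first exact: algebraic_val EP yE.
have [p [pm pE py]] := integral_of_places KE yO.
by exists p; rewrite monic_neq0.
Qed.

Lemma algebraicV E y : (forall c, iota c \in E) -> algebraic E y ->
  algebraic E y^-1.
Proof.
move=> KE yE; have [->|y0] := eqVneq y 0.
  by apply: algebraic_mem; rewrite invr0 rpred0.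
apply: contrapT => /(place_of_transcendental KE)[P [EP yM]].
have := val_idealV _ yM; rewrite invr_eq0 invrK => /(_ y0) /negP; apply.
exact: algebraic_val yE.
Qed.

Lemma algebraic_closed E : (forall c, iota c \in E) ->
  divring_closed [pred y | `[< algebraic E y >]].
Proof.
move=> KE; split=> [|x y /asboolP xE /asboolP yE|x y /asboolP xE /asboolP yE];
  apply/asboolP.
- by apply: algebraic_mem; exact: rpred1.
- by apply/algebraicP => // P EP; rewrite rpredB // (algebraic_val EP).
apply/algebraicP => // P EP; rewrite rpredM // (algebraic_val EP) //.
exact: algebraicV.
Qed.

Lemma algebraic_trans E E' y : (forall c, iota c \in E) ->
  (forall x, x \in E' -> algebraic E x) -> algebraic E' y -> algebraic E y.
Proof.
move=> KE E'E yE'; apply/algebraicP => // P EP; apply: algebraic_val yE'.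
by move=> x /E'E; exact: algebraic_val.
Qed.

Lemma algebraic_ideal P E x : (forall c, iota c \in E) ->
  {subset E <= val_ring P} -> algebraic E x -> x \in val_ideal P -> x = 0.
Proof.
move=> KE EO xE xM; apply/eqP; apply: contraTT (xM) => x0.
by apply: contraTN (algebraic_val EO (algebraicV KE xE)) => /(val_idealV x0).
Qed.

(** * Subfields generated by elements and fractions *)

Lemma gen_closed X : divring_closed (mem (subfield_gen iota X)).
Proof.
split=> [|x y /set_mem xX /set_mem yX|x y /set_mem xX /set_mem yX];
  apply: mem_set => L LL; have [[L1 LB LV] _] := LL; apply/set_mem.
- exact: L1.
- by apply: LB; apply: mem_set; [exact: xX|exact: yX].
- by apply: LV; apply: mem_set; [exact: xX|exact: yX].
Qed.

Definition gen X : divringClosed F := subfield_of (gen_closed X).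

Lemma gen_iota X c : iota c \in gen X.
Proof. by apply: mem_set => L [_]; apply; left; exists c. Qed.

Lemma gen_mem X x : X x -> x \in gen X.
Proof. by move=> Xx; apply: mem_set => L [_]; apply; right. Qed.

Lemma gen_sub X (S : {pred F}) : divring_closed S -> (forall c, iota c \in S) ->
  (forall x, X x -> x \in S) -> {subset gen X <= S}.
Proof.
move=> [S1 SB SV] KS XS y /set_mem yX.
suff: [set x | x \in S] y by [].
apply: yX; split.
  split=> [|u v /set_mem uS /set_mem vS|u v /set_mem uS /set_mem vS].
  - exact: mem_set.
  - by apply: mem_set; exact: SB.
  - by apply: mem_set; exact: SV.
by move=> x [[c _ <-]|Xx]; [exact: KS|exact: XS].
Qed.

Lemma gen_mono X (Y : set F) : X `<=` Y -> {subset gen X <= gen Y}.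
Proof.
move=> XY; apply: gen_sub => [|c|x /XY Yx].
- exact: gen_closed.
- exact: gen_iota.
- exact: gen_mem.
Qed.

End Places.

Section Fractions.
Context {F : fieldType}.
Implicit Types (A : subringClosed F).

Definition fractions (A : {pred F}) : {pred F} := [pred x |
  `[< exists a b, [/\ a \in A, b \in A, b != 0 & x = a / b] >]].

Lemma fractionsP A x :
  reflect (exists a b, [/\ a \in A, b \in A, b != 0 & x = a / b])
          (x \in fractions A).
Proof. exact: asboolP. Qed.

Lemma fractions_sub A : {subset A <= fractions A}.
Proof.
by move=> x xA; apply/fractionsP; exists x, 1; rewrite rpred1 oner_neq0 divr1.
Qed.

Lemma fractions_closed A : divring_closed (fractions A).
Proof.
split=> [|x y /fractionsP[a [b [aA bA b0 ->]]]
              /fractionsP[c [d [cA dA d0 ->]]]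
         |x y /fractionsP[a [b [aA bA b0 ->]]]
              /fractionsP[c [d [cA dA d0 ->]]]].
- by rewrite fractions_sub ?rpred1.
- apply/fractionsP; exists (a * d - c * b), (b * d).
  rewrite !(rpredB, rpredM) ?mulf_neq0 // mulrBl -mulf_div divff // mulr1.
  by rewrite (mulrC b d) -mulf_div divff // mulr1.
have [->|c0] := eqVneq c 0.
  by rewrite mul0r invr0 mulr0 fractions_sub ?rpred0.
apply/fractionsP; exists (a * d), (b * c).
by rewrite !rpredM // mulf_neq0 // invf_div mulf_div.
Qed.

HB.instance Definition _ A :=
  GRing.isDivringClosed.Build F (fractions A) (fractions_closed A).

Lemma clear_denominators A (p : {poly F}) : p \is a polyOver (fractions A) ->
  exists d, [/\ d \in A, d != 0 & d *: p \is a polyOver A].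
Proof.
elim/poly_ind: p => [|p c IHp] pA.
  by exists 1; rewrite rpred1 oner_neq0 scaler0 rpred0.
have [|d [dA d0 dp]] := IHp.
  apply/polyOverP => i; have /polyOverP/(_ i.+1) := pA.
  by rewrite coefD coefMX coefC addr0.
have /fractionsP[a [b [aA bA b0 cE]]] : c \in fractions A.
  by have /polyOverP/(_ 0%N) := pA; rewrite coefD coefMX coefC add0r.
exists (d * b); split; [by rewrite rpredM|by rewrite mulf_neq0|].
rewrite scalerDr rpredD //.
  by rewrite mulrC -scalerA [d *: _]scalerAl polyOverZ // rpredM ?polyOverX.
rewrite -mul_polyC -polyCM polyOverC cE -mulrA [b * _]mulrCA divff // mulr1.
by rewrite rpredM.
Qed.

Lemma algebraic_fractions A y : algebraic (fractions A) y -> algebraic A y.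
Proof.
case=> p [p0 /clear_denominators[d [dA d0 dp]] py].
by exists (d *: p); rewrite scaler_eq0 negb_or d0 p0 dp rootZ.
Qed.

End Fractions.

Section Families.
Context {K F : fieldType} (iota : {rmorphism K -> F}).
Context {I : Type} (t : I -> F).
Implicit Types (J : set I) (P : zariski_space iota).

Definition genI J := gen iota (t @` J).

Lemma genI_iota J c : iota c \in genI J.
Proof. exact: gen_iota. Qed.

Lemma genI_mem J i : J i -> t i \in genI J.
Proof. by move=> Ji; apply: gen_mem; exists i. Qed.

Lemma genI_mono J J' : J `<=` J' -> {subset genI J <= genI J'}.
Proof. by move=> JJ'; apply: gen_mono; exact: image_subset. Qed.

Lemma genI_adjoin J J' i : J' `<=` i |` J ->
  {subset genI J' <= fractions (adjoin (genI J) (t i))}.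
Proof.
move=> J'J; pose A := subring_of (adjoin_closed (genI J) (t i)).
apply: gen_sub => [|c|_ [j J'j <-]]; first exact: (fractions_closed A).
  by apply: (fractions_sub (A := A)); apply: adjoin_sub; exact: genI_iota.
apply: (fractions_sub (A := A)); have [->|Jj] := J'J _ J'j.
  exact: mem_adjoin.
by apply: adjoin_sub; exact: genI_mem.
Qed.

End Families.

(** * Minimal polynomials and lifting of places *)

Section MinimalPolynomials.
Context {K F : fieldType} (iota : {rmorphism K -> F}).
Implicit Types (A : subringClosed F) (E : divringClosed F) (b x y z : F).
Implicit Types (P Q : zariski_space iota) (f p q : {poly F}).

(** Divisibility in O_P is total, so a finite set has an element dividing the
    others. *)
Lemma dominant_elt P (s : seq F) : has (fun x => x != 0) s ->
  exists b, [/\ b \in s, b != 0 & forall x, x \in s -> x / b \in val_ring P].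
Proof.
elim: s => // a s IHs /=.
have [s0 _|s0] := boolP (has (fun x => x != 0) s); last first.
  rewrite orbF => a0; exists a; split; rewrite ?mem_head // => x.
  rewrite inE => /predU1P[->|xs]; first by rewrite divff ?rpred1.
  by move/hasPn/(_ _ xs): s0; rewrite negbK => /eqP->; rewrite mul0r rpred0.
have [b [bs b0 bdom]] := IHs s0.
have [ab|nab] := boolP (a / b \in val_ring P).
  exists b; split; rewrite ?inE ?bs ?orbT // => x.
  by rewrite inE => /predU1P[->//|/bdom].
have a0 : a != 0 by apply: contraNneq nab => ->; rewrite mul0r rpred0.
have ba : b / a \in val_ring P.
  have ab0 : a / b != 0 by rewrite mulf_neq0 ?invr_eq0.
  have [|/val_ideal_sub] := val_ring_or_ideal P ab0.
    by rewrite (negPf nab).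
  by rewrite invf_div.
exists a; split; rewrite ?mem_head // => x.
rewrite inE => /predU1P[->|/bdom xb]; first by rewrite divff ?rpred1.
by rewrite -(divfK b0 x) -[_ * b * _]mulrA rpredM.
Qed.

(** The coefficients outside the maximal ideal of least index in p and in q
    produce one in p * q, all other terms of that coefficient being in the
    ideal. *)
Lemma primitive_mul P p q : p \is a polyOver (val_ring P) ->
  q \is a polyOver (val_ring P) ->
  (exists i, p`_i \notin val_ideal P) -> (exists i, q`_i \notin val_ideal P) ->
  exists i, (p * q)`_i \notin val_ideal P.
Proof.
move=> /polyOverP pO /polyOverP qO exp exq.
case: (ex_minnP exp) => i pi imin; case: (ex_minnP exq) => j qj jmin.
have lti k : (k < i)%N -> p`_k \in val_ideal P.
  by move=> lt_ki; apply: contraLR lt_ki => /imin; rewrite -leqNgt.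
have ltj k : (k < j)%N -> q`_k \in val_ideal P.
  by move=> lt_kj; apply: contraLR lt_kj => /jmin; rewrite -leqNgt.
exists (i + j)%N; have lt_i : (i < (i + j).+1)%N by rewrite ltnS leq_addr.
rewrite coefM (bigD1 (Ordinal lt_i)) //= addKn; apply/negP => pqM.
have : p`_i * q`_j \in val_ideal P.
  rewrite -[X in X \in _](addrK (\sum_(k < (i + j).+1 | k != Ordinal lt_i)
    p`_k * q`_(i + j - k))); apply: val_idealD => //; apply: val_idealN.
  apply: val_ideal_sum => k; rewrite -val_eqE /= neq_ltn => /orP[/lti pM|lt_ik].
    by rewrite mulrC val_idealM.
  by rewrite val_idealM // ltj // ltn_subLR ?ltn_add2r // -ltnS.
by case/val_ideal_mulf => //; exact/negP.
Qed.

(** Gauss's lemma: scaled to content 1, the two factors remain nonzero in the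
    residue field, and so does their product. *)
Lemma gauss P f q : f \is monic -> q \is monic ->
  f * q \is a polyOver (val_ring P) -> f \is a polyOver (val_ring P).
Proof.
move=> fm qm fqO.
have content p : p \is monic -> exists a, [/\ a != 0, a^-1 \in val_ring P,
    a^-1 *: p \is a polyOver (val_ring P) &
    exists i, (a^-1 *: p)`_i \notin val_ideal P].
  move=> pm; have p0 : p != 0 by exact: monic_neq0.
  have [|a [ap a0 adom]] := @dominant_elt P p.
    apply/hasP; exists (lead_coef p); last by rewrite lead_coef_eq0.
    by rewrite lead_coefE mem_nth // prednK ?size_poly_gt0.
  exists a; split=> //.
  - rewrite -[a^-1]mul1r adom // -(monicP pm) lead_coefE.
    by rewrite mem_nth // prednK ?size_poly_gt0.
  - apply/polyOverP => i; rewrite coefZ mulrC.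
    have [lt_i|le_i] := ltnP i (size p); first by rewrite adom ?mem_nth.
    by rewrite nth_default // mul0r rpred0.
  - exists (index a p); rewrite coefZ nth_index // mulVf //.
    exact: one_notin_ideal.
have [a [a0 aVO apO exa]] := content f fm.
have [b [b0 bVO bqO exb]] := content q qm.
have [i /negP iM] := primitive_mul apO bqO exa exb.
have [aO|aVM] := val_ring_or_ideal P a0.
  by rewrite -[f](scalerKV a0) polyOverZ.
case: iM; rewrite -scalerAl -scalerAr scalerA coefZ mulrC val_idealM //.
  exact: (polyOverP fqO).
by rewrite mulrC val_idealM.
Qed.

Definition minimal_polynomial E b f :=
  [/\ f \is monic, f \is a polyOver E, root f b &
      forall p, p \is a polyOver E -> root p b -> (size p < size f)%N -> p = 0].

Lemma exists_minimal_polynomial E b : algebraic E b ->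
  exists f, minimal_polynomial E b f.
Proof.
move/algebraic_integral=> [g [gm gE gb]].
pose ann n := `[< exists f,
  [/\ f \is monic, f \is a polyOver E, root f b & size f = n] >].
have exann : exists n, ann n by exists (size g); apply/asboolP; exists g.
case: (ex_minnP exann) => n /asboolP[f [fm fE fb sf]] nmin.
exists f; split=> // p pE pb; rewrite sf => lt_p; apply: contraTeq lt_p => p0.
rewrite -leqNgt; apply: nmin; apply/asboolP; exists ((lead_coef p)^-1 *: p).
have lp0 : (lead_coef p)^-1 != 0 by rewrite invr_eq0 lead_coef_eq0.
split; rewrite ?rootZ ?size_scale //.
  by rewrite monicE lead_coefZ mulVf ?lead_coef_eq0.
by rewrite polyOverZ // rpredV; exact: (polyOverP pE).
Qed.

Lemma minimal_polynomial_dvd E A b f p : minimal_polynomial E b f ->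
  {subset A <= E} -> f \is a polyOver A -> p \is a polyOver A -> root p b ->
  exists2 q, q \is a polyOver A & p = q * f.
Proof.
move=> [fm fE fb fmin] AE fA pA pb.
have [q [r [qA rA pE sr]]] := division pA fA fm.
exists q => //; rewrite pE (fmin r) ?addr0 //; first exact: polyOver_sub AE _.
by move: pb; rewrite pE /root hornerD hornerM (rootP fb) mulr0 add0r.
Qed.

(** Lying in all valuation rings above A, b is integral over A, and Gauss's
    lemma carries integral coefficients from the integral equation to its
    divisor f. *)
Lemma minimal_polynomial_integral E A b f : (forall c, iota c \in A) ->
  {subset A <= E} ->
  (forall P, {subset A <= val_ring P} -> b \in val_ring P) ->
  minimal_polynomial E b f ->
  forall P, {subset A <= val_ring P} -> f \is a polyOver (val_ring P).
Proof.
move=> KA AE bA fmin P AP; have [g [gm gA gb]] := integral_of_places KA bA.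
have [fm fE _ _] := fmin.
have gL : g \is a polyOver E by exact: polyOver_sub AE _.
have [|q _ gE] := minimal_polynomial_dvd (A := E) fmin _ fE gL gb.
  by [].
have qm : q \is monic by rewrite -(monicMr _ fm) -gE.
by apply: (gauss fm qm); rewrite mulrC -gE; exact: polyOver_sub AP _.
Qed.

Lemma minimal_polynomial_coef0 E b f : minimal_polynomial E b f -> b != 0 ->
  f`_0 != 0.
Proof.
move=> [fm fE fb fmin] b0; apply/eqP => f00.
have fX : f = drop_poly 1 f * 'X.
  rewrite -[LHS](poly_take_drop 1) expr1 [take_poly _ _](_ : _ = 0) ?add0r //.
  by apply/polyP => i; rewrite coef_take_poly coef0; case: i.
have f0 : f != 0 by exact: monic_neq0.
have d0 : drop_poly 1 f != 0 by apply: contraNneq f0 => d0; rewrite fX d0 mul0r.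
suff : drop_poly 1 f = 0 by move/eqP; exact/negP.
apply: fmin.
- by apply/polyOverP => i; rewrite coef_drop_poly (polyOverP fE).
- by move: fb; rewrite {1}fX rootM rootX (negPf b0) orbF.
by have := size_mulX d0; rewrite -fX => ->.
Qed.

Lemma minimal_polynomial_coef0_ideal P b f : f \is a polyOver (val_ring P) ->
  root f b -> b \in val_ideal P -> f`_0 \in val_ideal P.
Proof.
move=> fO fb bM.
have fX : f = (f`_0)%:P + drop_poly 1 f * 'X.
  rewrite -[LHS](poly_take_drop 1) expr1; congr (_ + _).
  by apply/polyP => i; rewrite coef_take_poly coefC; case: i.
move/rootP: fb; rewrite {1}fX !hornerE => /eqP; rewrite addr_eq0 => /eqP->.
rewrite val_idealN // val_idealM // rpred_horner ?val_ideal_sub //.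
by apply/polyOverP => i; rewrite coef_drop_poly (polyOverP fO).
Qed.

(** If b were a unit of A[b], where A is the intersection of E and O_P, then f
    would divide 'X * g - 1 in A[X] for some g, and -1 would be a multiple of
    f(0) in O_P. *)
Lemma lift_place P E b f : (forall c, iota c \in E) -> b != 0 ->
  minimal_polynomial E b f -> f \is a polyOver (val_ring P) ->
  f`_0 \in val_ideal P ->
  exists Q, (forall x, x \in E -> x \in val_ring P -> x \in val_ring Q) /\
    b \in val_ideal Q.
Proof.
move=> KE b0 fmin fO f0M.
have clA : subring_closed [predI E & val_ring P].
  split=> [|x y|x y]; rewrite !inE ?rpred1 // => /andP[xE xO] /andP[yE yO].
    by rewrite !rpredB.
  by rewrite !rpredM.
pose A := subring_of clA.
have AE : {subset A <= E} by move=> x /andP[].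
have AO : {subset A <= val_ring P} by move=> x /andP[].
have KA c : iota c \in A by apply/andP; split; [exact: KE|exact: val_ringK].
have fA : f \is a polyOver A.
  case: fmin => _ fE _ _; apply/polyOverP => i; apply/andP.
  by split; [exact: (polyOverP fE)|exact: (polyOverP fO)].
have [|Q [AQ bM]] := place_of_nonunit (A := A) (b := b) KA; last first.
  by exists Q; split=> // x xE xO; apply: AQ; apply/andP.
apply/negP => /adjoinP[g gA gb].
have [||q qA gE] := minimal_polynomial_dvd (p := 'X * g - 1) fmin AE fA.
- by rewrite rpredB ?rpredM ?polyOverX ?rpred1.
- by rewrite rootE !hornerE -gb mulfV ?subrr.
case/negP: (one_notin_ideal P); rewrite -[1]opprK val_idealN //.
have -> : -1 = q.[0] * f`_0.
  have /(congr1 (fun h : {poly F} => h.[0])) := gE.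
  rewrite hornerD hornerN hornerM hornerX hornerC mul0r add0r.
  by rewrite hornerM (horner_coef0 f).
rewrite val_idealM // rpred_horner ?rpred0 //; exact: polyOver_sub AO _.
Qed.

End MinimalPolynomials.

(** * Simple transcendental extensions *)

Section SimpleTranscendental.
Context {K F : fieldType} (iota : {rmorphism K -> F}).
Implicit Types (E : divringClosed F) (s x y z : F).
Implicit Types (P Q : zariski_space iota) (f p q : {poly F}).

Lemma simple_fractionP E s x : x \in fractions (adjoin E s) ->
  exists p q, [/\ p \is a polyOver E, q \is a polyOver E, q.[s] != 0 &
    x = p.[s] / q.[s]].
Proof.
move=> /(fractionsP (subring_of (adjoin_closed E s))).
by case=> _ [_ [/adjoinP[p pE ->] /adjoinP[q qE ->] q0 ->]]; exists p, q.
Qed.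

(** With x = p(s)/q(s), the polynomial x *: q - p over E'(x) kills s; as s is
    transcendental over E'(x) it vanishes, and x is a quotient of coefficients
    of p and q. *)
Lemma simple_transcendental_descent E E' s x : (forall c, iota c \in E) ->
  {subset E <= E'} -> ~ algebraic E' s -> algebraic E' x ->
  x \in fractions (adjoin E s) -> x \in E.
Proof.
move=> KE EE' str xE' /simple_fractionP[p [q [pE qE qs0 xE]]].
have KE' c : iota c \in E' by apply: EE'.
pose E1 := subfield_of (algebraic_closed KE').
have E1P z : z \in E1 -> algebraic E' z by move/asboolP.
have EE1 : {subset E <= E1}.
  by move=> z zE; apply/asboolP; apply: algebraic_mem; apply: EE'.
have [xqp|xqp] := eqVneq (x *: q - p) 0.
  move/eqP: xqp; rewrite subr_eq0 => /eqP xqp.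
  have q0 : q != 0 by apply: contraNneq qs0 => ->; rewrite horner0.
  rewrite -(mulfK (_ : lead_coef q != 0) x) ?lead_coef_eq0 // -lead_coefZ xqp.
  by rewrite rpredM ?rpredV //; [exact: (polyOverP pE)|exact: (polyOverP qE)].
case: str; apply: (algebraic_trans KE' E1P); exists (x *: q - p); split=> //.
  rewrite rpredB ?polyOverZ //; first exact/asboolP; exact: polyOver_sub EE1 _.
by rewrite rootE !hornerE xE divfK ?subrr.
Qed.

(** Divided by this power of s, the polynomial is its leading coefficient, a
    unit because it lies in E, up to an element of the maximal ideal. *)
Lemma horner_at_pole P E s p :
  {subset E <= val_ring P} -> s \notin val_ring P ->
  p \is a polyOver E -> p != 0 ->
  exists u, [/\ u \in val_ring P, u^-1 \in val_ring P, u != 0 &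
    p.[s] = u * s ^+ (size p).-1].
Proof.
move=> EP sP /polyOverP pE p0.
have s0 : s != 0 by apply: contraNneq sP => ->; rewrite rpred0.
have [|sVM] := val_ring_or_ideal P s0; first by rewrite (negPf sP).
have sp : (0 < size p)%N by rewrite size_poly_gt0.
pose r := \sum_(i < (size p).-1) p`_i * s^-1 ^+ ((size p).-1 - i).
have rM : r \in val_ideal P.
  apply: val_ideal_sum => i _; rewrite val_idealM ?EP //.
  have k0 : (0 < (size p).-1 - i)%N by rewrite subn_gt0.
  by rewrite -(prednK k0) exprSr val_idealM // rpredX // val_ideal_sub.
have lM : lead_coef p \notin val_ideal P.
  by apply: contra p0 => /(subfield_ideal EP (pE _))/eqP; rewrite lead_coef_eq0.
have uM : lead_coef p + r \notin val_ideal P.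
  apply: contra lM => uM; rewrite -(addrK r (lead_coef p)).
  by rewrite val_idealD ?val_idealN.
have uO : lead_coef p + r \in val_ring P.
  by rewrite rpredD //; [exact: EP (pE _)|exact: val_ideal_sub].
exists (lead_coef p + r); split=> //; first exact: unit_notin_ideal.
  by apply: contraNneq uM => ->; exact: val_ideal0.
rewrite mulrDl horner_coef -[in LHS](prednK sp) big_ord_recr /= addrC.
congr (_ + _).
rewrite mulr_suml; apply: eq_bigr => i _; rewrite -mulrA; congr (_ * _).
rewrite (_ : s ^+ (size p).-1 = s ^+ ((size p).-1 - i) * s ^+ i).
  by rewrite exprVn mulrA mulVf ?mul1r // expf_neq0.
by rewrite -exprD subnK // ltnW.
Qed.

(** If there were no such place, x and 1/x would be integral at every place
    finite at s. Where s has a pole, x is integral if the degree of its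
    numerator is at most that of its denominator, and 1/x is integral otherwise.
    So x or 1/x would be integral at every place above E, hence algebraic
    over E. *)
Lemma finite_zero_or_pole E s x : (forall c, iota c \in E) -> ~ algebraic E x ->
  x \in fractions (adjoin E s) ->
  exists P, [/\ {subset E <= val_ring P}, s \in val_ring P &
    x \in val_ideal P \/ x^-1 \in val_ideal P].
Proof.
move=> KE xtr /simple_fractionP[p [q [pE qE qs0 xE]]].
apply: contrapT => noP.
have x0 : x != 0.
  apply/eqP => x0; apply: xtr; rewrite x0.
  by apply: algebraic_mem; exact: rpred0.
have finO P : {subset E <= val_ring P} -> s \in val_ring P ->
    x \in val_ring P /\ x^-1 \in val_ring P.
  move=> EP sP; have [xO|xVM] := val_ring_or_ideal P x0; last first.
    by case: noP; exists P; split=> //; right.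
  split=> //; apply: unit_notin_ideal => //; apply/negP => xM.
  by case: noP; exists P; split=> //; left.
have p0 : p != 0 by apply: contraNneq x0 => p0; rewrite xE p0 horner0 mul0r.
have q0 : q != 0 by apply: contraNneq qs0 => ->; rewrite horner0.
have pole_val f g P : f \is a polyOver E -> g \is a polyOver E ->
    f != 0 -> g != 0 -> (size f <= size g)%N ->
    {subset E <= val_ring P} -> s \notin val_ring P ->
    f.[s] / g.[s] \in val_ring P.
  move=> fE gE f0 g0 le_fg EP sP.
  have [u [uO _ u0 ->]] := horner_at_pole EP sP fE f0.
  have [v [_ vVO v0 ->]] := horner_at_pole EP sP gE g0.
  have s0 : s != 0 by apply: contraNneq sP => ->; rewrite rpred0.
  have [|sVM] := val_ring_or_ideal P s0; first by rewrite (negPf sP).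
  rewrite -mulf_div; apply: rpredM; first by rewrite rpredM.
  have le_fg' : ((size f).-1 <= (size g).-1)%N by rewrite -!subn1 leq_sub2r.
  rewrite -(subnK le_fg') exprD invfM mulrCA mulfV ?expf_neq0 // mulr1 -exprVn.
  by rewrite rpredX // val_ideal_sub.
have [le_pq|/ltnW le_qp] := leqP (size p) (size q).
  apply: xtr; apply/(algebraicP _ KE) => P EP.
  have [sP|sP] := boolP (s \in val_ring P); first by case: (finO P EP sP).
  by rewrite xE; exact: pole_val.
apply: xtr; suff xV : algebraic E x^-1.
  by have := algebraicV KE xV; rewrite invrK.
apply/(algebraicP _ KE) => P EP.
have [sP|sP] := boolP (s \in val_ring P); first by case: (finO P EP sP).
by rewrite xE invf_div; exact: pole_val.
Qed.

(** Steinitz exchange: a relation between s and y is read as a polynomial in s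
    whose coefficients are polynomials in y. *)
Lemma algebraic_exchange E E' s y : {subset E <= E'} -> y \in E' ->
  algebraic (fractions (adjoin E s)) y -> ~ algebraic E y -> algebraic E' s.
Proof.
move=> EE' yE' /(algebraic_fractions (A := subring_of (adjoin_closed E s))).
move=> [p [p0 /polyOverP pEs py]] ytr.
have pEx k : exists f, f \is a polyOver E /\ p`_k = f.[s].
  by have /adjoinP[f] := pEs k; exists f.
have [f fP] := choice pEx.
pose d := \max_(k < size p) size (f k).
pose g i := \poly_(k < size p) (f k)`_i.
pose r := \poly_(i < d) (g i).[y].
have gE i : g i \is a polyOver E.
  by apply: polyOver_poly => k _; have [/polyOverP] := fP k.
have [r0|r0] := eqVneq r 0; last first.
  exists r; split=> //.
    apply: polyOver_poly => i _; rewrite rpred_horner //.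
    exact: polyOver_sub EE' (gE i).
  apply/rootP; rewrite -(rootP py) /r horner_poly [RHS]horner_coef.
  under eq_bigr do rewrite /g horner_poly mulr_suml.
  rewrite exchange_big /=; apply: eq_bigr => k _.
  have [_ ->] := fP k; rewrite (@horner_coef_wide _ d) ?leq_bigmax // mulr_suml.
  by apply: eq_bigr => i _; rewrite mulrAC.
case/eqP: p0; apply/polyP => k; rewrite coef0.
have [lt_k|le_k] := ltnP k (size p); last by rewrite nth_default.
have [_ ->] := fP k; rewrite (_ : f k = 0) ?horner0 //; apply/polyP => i.
rewrite coef0; have [lt_i|le_i] := ltnP i d; last first.
  by rewrite nth_default // (leq_trans _ le_i) // (leq_bigmax (Ordinal lt_k)).
have gi0 : g i = 0.
  apply: contrapT => /eqP gi0; apply: ytr; exists (g i); split=> //.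
  rewrite rootE; have := congr1 (fun h : {poly F} => h`_i) r0.
  by rewrite coef_poly lt_i coef0 => ->.
by have := congr1 (fun h : {poly F} => h`_k) gi0; rewrite coef_poly lt_k coef0.
Qed.

End SimpleTranscendental.

Section Families.
Context {K F : fieldType} (iota : {rmorphism K -> F}) (m : nat) (t : 'I_m -> F).

Definition others (i : 'I_m) := genI iota t [set j | j != i].

(** If x is algebraic over K(t_j, j <> k) for every k, the descent lemma
    removes t_0, t_1, ... one after the other from a field containing x, until
    only K is left. *)
Lemma exists_transcendental_over_others x :
  (forall i, ~ algebraic (others i) (t i)) -> x \in genI iota t setT ->
  (forall c, x != iota c) -> exists i, ~ algebraic (others i) x.
Proof.
move=> ttr xt xK; apply: contrapT => /forallNP xalg.
pose E k := genI iota t [set j : 'I_m | (k <= j)%N].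
have xE k : (k <= m)%N -> x \in E k.
  elim: k => [_|k IHk lt_km]; first by apply: (genI_mono _ xt).
  pose i := Ordinal lt_km.
  apply: (simple_transcendental_descent (E' := others i) (s := t i)).
  - by move=> c; exact: genI_iota.
  - apply: genI_mono => j /= lt_kj.
    by apply: contraTneq lt_kj => ->; rewrite ltnn.
  - exact: ttr.
  - exact: contrapT.
  - apply: (genI_adjoin (J' := [set j : 'I_m | (k <= j)%N])); last first.
      exact: IHk (ltnW _).
    move=> j /=; rewrite leq_eqVlt => /orP[/eqP kj|lt_kj]; [left|by right].
    exact: val_inj.
have : x \in [pred y | `[< exists c, y = iota c >]].
  apply: (gen_sub _ _ _ (xE m (leqnn m))).
  - split=> [|y z /asboolP[c ->] /asboolP[d ->]
             |y z /asboolP[c ->] /asboolP[d ->]]; apply/asboolP.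
    + by exists 1; rewrite rmorph1.
    + by exists (c - d); rewrite rmorphB.
    + by exists (c / d); rewrite fmorph_div.
  - by move=> c; apply/asboolP; exists c.
  - by move=> y [j /=]; rewrite leqNgt ltn_ord.
by case/asboolP=> c /eqP; exact/negP.
Qed.

End Families.

(** * Algebraic independence *)

Section Mpoly.
Context {K : fieldType}.

Lemma mpoly_rmorph_eq (S : comNzRingType) (n : nat)
    (f g : {rmorphism {mpoly K[n]} -> S}) :
  (forall c, f c%:MP = g c%:MP) -> (forall i, f 'X_i = g 'X_i) -> f =1 g.
Proof.
move=> fgC fgX p; rewrite (mpolyE p) !raddf_sum; apply: eq_bigr => k _ /=.
rewrite -mul_mpolyC !rmorphM /= fgC mpolyXE_id !rmorph_prod; congr (_ * _).
by apply: eq_bigr => i _; rewrite !rmorphXn /= fgX.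
Qed.

Lemma rpred_mmap (F : fieldType) (iota : {rmorphism K -> F}) (n : nat)
    (x : 'I_n -> F) (A : subringClosed F) p :
  (forall c, iota c \in A) -> (forall i, x i \in A) -> mmap iota x p \in A.
Proof.
move=> KA xA; rewrite rpred_sum // => k _; rewrite rpredM //.
by rewrite rpred_prod // => i _; rewrite rpredX.
Qed.

Context {F : fieldType} (iota : {rmorphism K -> F}).

Lemma alg_independent_sub n m (h : 'I_n -> 'I_m) (t : 'I_m -> F) :
  injective h -> alg_independent iota t -> alg_independent iota (t \o h).
Proof.
move=> hinj tind p p0.
pose e := mmap (@mpolyC m K) (fun j => 'X_(h j)) : {mpoly K[n]} -> {mpoly K[m]}.
pose r := mmap (@mpolyC n K)
  (fun j => if [pick k | h k == j] is Some k then 'X_k else 0)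
  : {mpoly K[m]} -> {mpoly K[n]}.
have er : cancel e r.
  move=> q; apply: (@mpoly_rmorph_eq _ _ (r \o e) idfun) => [c|i] /=.
    by rewrite /e /r !mmapC.
  rewrite /e mmapX mmap1U /r mmapX mmap1U.
  by case: pickP => [k /eqP/hinj->|/(_ i)] //; rewrite eqxx.
rewrite -(er p) (tind (e p)); first by rewrite /r rmorph0.
rewrite -p0.
apply: (@mpoly_rmorph_eq _ _ (mmap iota t \o e) (mmap iota (t \o h)))
  => [c|i] /=.
  by rewrite /e !mmapC.
by rewrite /e !mmapX !mmap1U mmapX mmap1U.
Qed.

(** The morphism phi below reads the variable of index i as a polynomial
    variable over the others and so separates the powers of t i. The polynomials
    free of that variable are those sent to constants; their values form a ring
    whose fractions contain the field generated by the other t j, so a relation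
    for t i over that field is one with coefficients in the ring. *)
Lemma alg_independent_transcendental m (t : 'I_m -> F) i :
  alg_independent iota t -> ~ algebraic (others iota t i) (t i).
Proof.
move=> tind ti.
pose phi : {rmorphism {mpoly K[m]} -> {poly {mpoly K[m]}}} :=
  mmap (polyC \o @mpolyC m K) (fun j => if j == i then 'X else ('X_j)%:P).
have phiC c : phi c%:MP = c%:MP%:P by exact: mmapC.
have phiX j : phi 'X_j = if j == i then 'X else ('X_j)%:P.
  by rewrite /phi /= mmapX mmap1U.
pose free := [pred y | `[< exists G, phi G = G%:P /\ y = mmap iota t G >]].
have clfree : subring_closed free.
  split=> [|_ _ /asboolP[G [GC ->]] /asboolP[H [HC ->]]
           |_ _ /asboolP[G [GC ->]] /asboolP[H [HC ->]]]; apply/asboolP.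
  - by exists 1; rewrite !rmorph1.
  - by exists (G - H); rewrite !rmorphB /= GC HC.
  - by exists (G * H); rewrite !rmorphM /= GC HC.
pose A := subring_of clfree.
have tiA : algebraic A (t i).
  apply: algebraic_fractions; apply: algebraicS ti.
  apply: gen_sub => [|c|_ [j /= ji <-]]; first exact: fractions_closed.
    apply: (fractions_sub (A := A)); apply/asboolP; exists c%:MP.
    by rewrite phiC mmapC.
  apply: (fractions_sub (A := A)); apply/asboolP; exists 'X_j.
  by rewrite phiX mmapX mmap1U (negPf ji).
have [p [p0 /polyOverP pA pt]] := tiA.
have [G GP] := choice (fun k => asboolP _ (pA k)).
pose H := \sum_(k < size p) G k * 'X_i ^+ k.
have H0 : H = 0.
  apply: tind; rewrite -(rootP pt) horner_coef raddf_sum.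
  apply: eq_bigr => k _ /=.
  by rewrite rmorphM rmorphXn /= mmapX mmap1U -(GP k).2.
case/eqP: p0; apply/polyP => k; rewrite coef0.
have [lt_k|le_k] := ltnP k (size p); last by rewrite nth_default.
rewrite (GP k).2 (_ : G k = 0) ?raddf0 //.
have phiH : phi H = \poly_(k < size p) G k.
  rewrite poly_def raddf_sum; apply: eq_bigr => j _ /=.
  by rewrite rmorphM rmorphXn /= (GP j).1 phiX eqxx mul_polyC.
have := congr1 (fun h : {poly {mpoly K[m]}} => h`_k) phiH.
by rewrite H0 rmorph0 coef0 coef_poly lt_k.
Qed.

End Mpoly.

(** * The residue field of a place trivial on all but one variable *)

Section ResidueMorphisms.
Context {K F : fieldType} {iota : {rmorphism K -> F}} (Q : zariski_space iota).

Lemma residue_zmod : zmod_morphism (@residue K F iota Q).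
Proof. by move=> u v; rewrite /residue rmorphB. Qed.

Lemma residue_monoid : monoid_morphism (@residue K F iota Q).
Proof.
split=> [|u v]; rewrite /residue.
  by rewrite -[RHS](rmorph1 \pi_({ideal_quot (@max_ideal _ _ _ Q)})).
by rewrite -[RHS]rmorphM.
Qed.

HB.instance Definition _ := GRing.isZmodMorphism.Build
  (val_ring_type Q) (residue_field Q) (@residue K F iota Q) residue_zmod.
HB.instance Definition _ := GRing.isMonoidMorphism.Build
  (val_ring_type Q) (residue_field Q) (@residue K F iota Q) residue_monoid.

Definition const_elt (c : K) : val_ring_type Q := ValRingElem (val_ringK Q c).

Lemma const_elt_zmod : zmod_morphism const_elt.
Proof. by move=> c d; apply: val_inj; rewrite /= rmorphB. Qed.

Lemma const_elt_monoid : monoid_morphism const_elt.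
Proof.
by split=> [|c d]; apply: val_inj; rewrite /= ?rmorph1 ?rmorphM.
Qed.

HB.instance Definition _ := GRing.isZmodMorphism.Build
  K (val_ring_type Q) const_elt const_elt_zmod.
HB.instance Definition _ := GRing.isMonoidMorphism.Build
  K (val_ring_type Q) const_elt const_elt_monoid.

Lemma val_mmap n (u : 'I_n -> val_ring_type Q) p :
  val (mmap const_elt u p) = mmap iota (val \o u) p.
Proof.
apply: (@mpoly_rmorph_eq _ _ _ (val \o mmap const_elt u)
  (mmap iota (val \o u))) => [c|i] /=; first by rewrite !mmapC.
by rewrite !mmapX !mmap1U.
Qed.

Lemma residue_mmap n (u : 'I_n -> val_ring_type Q) p :
  residue (mmap const_elt u p) = mmap (residue_emb Q) (@residue _ _ _ Q \o u) p.
Proof.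
apply: (@mpoly_rmorph_eq _ _ _ (@residue _ _ _ Q \o mmap const_elt u)
  (mmap (residue_emb Q) (@residue _ _ _ Q \o u))) => [c|i] /=.
  by rewrite !mmapC.
by rewrite !mmapX !mmap1U.
Qed.

End ResidueMorphisms.

Section ResidueField.
Context {K F : fieldType} (iota : {rmorphism K -> F}) (n : nat).
Variables (t : 'I_n.+1 -> F) (i : 'I_n.+1) (Q : zariski_space iota).
Hypothesis tind : alg_independent iota t.
Hypothesis Falg : forall y, algebraic (genI iota t setT) y.
Local Notation E := (others iota t i).
Hypothesis EQ : {subset E <= val_ring Q}.

Let tQ j : t (lift i j) \in val_ring Q.
Proof. by apply: EQ; apply: genI_mem; rewrite /= eq_sym neq_lift. Qed.

Let u j : val_ring_type Q := ValRingElem (tQ j).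

Let residue_independent :
  alg_independent (residue_emb Q) (@residue _ _ _ Q \o u).
Proof.
move=> p; rewrite -residue_mmap => /eqP; rewrite residue_eq0 val_mmap => pM.
apply: (alg_independent_sub (@lift_inj _ i) tind).
apply: subfield_ideal EQ _ pM; apply: rpred_mmap => [c|j].
  exact: genI_iota.
by apply: genI_mem; rewrite /= eq_sym neq_lift.
Qed.

(** The elements of E whose residue is generated as required form a subfield:
    reduction is defined on all of E and kills none of its nonzero elements. *)
Let residue_gen (v : val_ring_type Q) : val v \in E ->
  residue v \in gen (residue_emb Q) (range (@residue _ _ _ Q \o u)).
Proof.
set G := gen _ _; move=> vE.
pose S := [pred z | (z \in E) &&
  `[< forall w : val_ring_type Q, val w = z -> residue w \in G >]].
suff /(_ _ vE)/andP[_ /asboolP] : {subset E <= S} by apply.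
apply: gen_sub => [|c|_ [j /= ji <-]].
- split=> [|y z /andP[yE /asboolP yG] /andP[zE /asboolP zG]
           |y z /andP[yE /asboolP yG] /andP[zE /asboolP zG]]; apply/andP.
  + split; [exact: rpred1|apply/asboolP => w w1].
    by rewrite (_ : w = 1) ?rmorph1 ?rpred1 //; exact: val_inj.
  + split; [exact: rpredB|apply/asboolP => w wE].
    pose y' := ValRingElem (EQ yE); pose z' := ValRingElem (EQ zE).
    rewrite (_ : w = y' - z'); last exact: val_inj.
    by rewrite rmorphB; apply: rpredB; [exact: yG|exact: zG].
  + split; [exact: rpred_div|apply/asboolP => w wE].
    pose y' := ValRingElem (EQ yE); pose z' := ValRingElem (EQ zE).
    have [z0|z0] := eqVneq z 0.
      rewrite (_ : w = 0) ?rmorph0 ?rpred0 //; apply: val_inj.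
      by rewrite wE z0 invr0 mulr0.
    have rz0 : residue z' != 0.
      rewrite residue_eq0; apply: contra z0 => zM; apply/eqP.
      exact: subfield_ideal EQ zE zM.
    rewrite -[residue w](mulfK rz0) -rmorphM; apply: rpred_div; last exact: zG.
    by apply: yG; rewrite /= wE divfK.
- rewrite !inE genI_iota; apply/asboolP => w wE.
  rewrite (_ : w = const_elt Q c); last exact: val_inj.
  exact: (gen_iota (residue_emb Q) _ c).
- rewrite !inE genI_mem //; apply/asboolP => w wE.
  have [k|] := unliftP i j; last by move=> ji'; rewrite ji' eqxx in ji.
  move=> jk; apply: gen_mem; exists k => //=; congr residue; apply: val_inj.
  by rewrite /= wE jk.
Qed.

(** If no nonzero polynomial over E sent y into the maximal ideal, y would be
    transcendental over E with E(y) contained in O_Q; by exchange F would be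
    algebraic over E(y), so its elements in the maximal ideal would be zero,
    unlike b. *)
Let relation_in_ideal b y : b != 0 -> b \in val_ideal Q -> y \in val_ring Q ->
  exists p, [/\ p != 0, p \is a polyOver E & p.[y] \in val_ideal Q].
Proof.
move=> b0 bM yQ; apply: contrapT => nop.
have pU p : p \is a polyOver E -> p != 0 -> p.[y] \notin val_ideal Q.
  by move=> pE p0; apply/negP => pM; apply: nop; exists p.
have KE c : iota c \in E by exact: genI_iota.
pose A := subring_of (adjoin_closed E y).
pose Ey := subfield_of (fractions_closed A).
have pO p : p \is a polyOver E -> p.[y] \in val_ring Q.
  by move=> pE; rewrite rpred_horner //; exact: polyOver_sub EQ _.
have EyQ : {subset Ey <= val_ring Q}.
  move=> _ /simple_fractionP[p [q [pE qE qy0 ->]]].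
  rewrite rpredM ?pO //; apply: unit_notin_ideal; first exact: pO.
  by apply: pU => //; apply: contraNneq qy0 => ->; rewrite horner0.
have EEy : {subset E <= Ey}.
  by move=> x xE; apply: (fractions_sub (A := A)); exact: adjoin_sub.
have KEy c : iota c \in Ey by apply: EEy.
have yEy : y \in Ey by apply: (fractions_sub (A := A)); exact: mem_adjoin.
have ytr : ~ algebraic E y.
  by case=> p [p0 pE /rootP py]; move: (pU p pE p0); rewrite py val_ideal0.
have ti : algebraic Ey (t i).
  apply: (algebraic_exchange EEy yEy _ ytr).
  apply: algebraicS (Falg y); apply: genI_adjoin => j _ /=.
  by have [->|] := eqVneq j i; [left|right].
have LEy x : x \in genI iota t setT -> algebraic Ey x.
  move=> xL; apply/asboolP.
  apply: (gen_sub (algebraic_closed KEy) _ _ xL) => [c|_ [j _ <-]];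
    apply/asboolP.
    exact: algebraic_mem.
  have [->//|ji] := eqVneq j i.
  by apply: algebraic_mem; apply: EEy; exact: genI_mem.
have bEy := algebraic_trans KEy LEy (Falg b).
by move/eqP: b0; apply; exact: algebraic_ideal KEy EyQ bEy bM.
Qed.

Lemma residue_trdeg b : b != 0 -> b \in val_ideal Q ->
  has_trdeg (residue_emb Q) n.
Proof.
move=> b0 bM; exists (@residue _ _ _ Q \o u); split.
  exact: residue_independent.
move=> a; have ra : residue (repr a) = a by exact: reprK.
have [p [p0 /polyOverP pE pM]] :=
  relation_in_ideal b0 bM (val_ring_valP (repr a)).
pose p' : {poly val_ring_type Q} := \poly_(k < size p) insubd 0 p`_k.
have p'E k : val p'`_k = p`_k.
  rewrite coef_poly; have [lt_k|le_k] := ltnP k (size p).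
    by rewrite val_insubd EQ.
  by rewrite nth_default.
exists (map_poly (@residue _ _ _ Q) p'); split.
- apply/eqP => /polyP p'0; case/eqP: p0; apply/polyP => k; rewrite coef0.
  apply: (subfield_ideal EQ (pE k)).
  by have /eqP := p'0 k; rewrite coef_map coef0 residue_eq0 p'E.
- apply/(all_nthP 0) => k _; rewrite coef_map; apply: residue_gen.
  by rewrite p'E.
rewrite rootE -{1}ra horner_map residue_eq0.
rewrite (_ : val _ = p.[val (repr a)]) // -horner_map.
congr (_.[_]); apply/polyP => k; rewrite coef_map; exact: p'E.
Qed.

End ResidueField.

(** * Noether normalization *)

Section Nagata.
Context {K F : fieldType} (iota : {rmorphism K -> F}).
Implicit Types (P : zariski_space iota).

(** The exponents of k read as digits in base N: when variable j takes the value
    z ^ (N ^ j), the monomial k takes the value z ^ (weight N k). *)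
Definition weight N n (k : 'X_{1..n}) := (\sum_(j < n) k j * N ^ j)%N.

Lemma weight_inj N n (k l : 'X_{1..n}) : (forall j, k j < N)%N ->
  (forall j, l j < N)%N -> weight N k = weight N l -> k = l.
Proof.
move=> kN lN kl; apply/mnmP => j.
suff key (f g : nat -> nat) : (forall j, f j < N)%N -> (forall j, g j < N)%N ->
    (\sum_(j < n) f j * N ^ j = \sum_(j < n) g j * N ^ j)%N ->
    forall j, (j < n)%N -> f j = g j.
  pose e (h : 'X_{1..n}) j := if insub j is Some o then h o else 0%N.
  have eE (h : 'X_{1..n}) (o : 'I_n) : e h o = h o by rewrite /e valK.
  have eN (h : 'X_{1..n}) : (forall j, h j < N)%N -> forall j, (e h j < N)%N.
    move=> hN o; rewrite /e; case: insub => [o'|]; rewrite ?hN //.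
    by rewrite (leq_ltn_trans _ (hN j)).
  rewrite -(eE k) -(eE l); apply: key => //; [exact: eN|exact: eN|].
  under eq_bigr do rewrite eE; under [RHS]eq_bigr do rewrite eE.
  exact: kl.
elim: n f g {k l kN lN kl j} => // n IHn f g fN gN.
have N0 : (0 < N)%N by apply: leq_ltn_trans (fN 0%N).
have split_sum (h : nat -> nat) :
    (\sum_(j < n.+1) h j * N ^ j = h 0 + (\sum_(j < n) h j.+1 * N ^ j) * N)%N.
  rewrite big_ord_recl expn0 muln1 big_distrl /=; congr (_ + _)%N.
  by apply: eq_bigr => j _; rewrite /bump add1n expnSr mulnA.
rewrite !split_sum => eq_fg.
have f0 : f 0%N = g 0%N.
  have := congr1 (modn^~ N) eq_fg.
  by rewrite ![(_ + _ * N)%N]addnC !modnMDl !modn_small.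
move: eq_fg; rewrite f0 => /addnI/eqP; rewrite eqn_pmul2r // => /eqP eq_fg.
move=> [//|j]; rewrite ltnS.
exact: (IHn (fun j => f j.+1) (fun j => g j.+1)).
Qed.

Lemma mmap1_principal_unit P n (e : 'I_n -> F) (k : 'X_{1..n}) :
  (forall j, e j - 1 \in val_ideal P) -> mmap1 e k - 1 \in val_ideal P.
Proof.
pose U x := x - 1 \in val_ideal P.
have U1 : U 1 by rewrite /U subrr val_ideal0.
have UM x y : U x -> U y -> U (x * y).
  move=> Ux Uy; rewrite /U (_ : _ - 1 = (x - 1) + x * (y - 1)).
    rewrite val_idealD // val_idealM // -(subrK 1 x) rpredD ?rpred1 //.
    exact: val_ideal_sub.
  by rewrite mulrBr mulr1 [RHS]addrC addrA subrK.
move=> eU; rewrite -/(U _) /mmap1; elim/big_ind: _ => // j _.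
by elim: (k j) => [|d IHd]; rewrite ?expr0 // exprS; apply: UM => //; exact: eU.
Qed.

(** If z is not in O_P then each x j is a principal unit times z ^ (N ^ j), so
    the monomials of p(x) are principal units times the powers of z given by
    their weights; these are distinct, and a single one dominates. *)
Lemma nagata_pole P n N (x : 'I_n -> F) z (p : {mpoly K[n]}) :
  (forall k, k \in msupp p -> forall j, (k j < N)%N) -> p != 0 ->
  z \notin val_ring P ->
  (forall j, x j - z ^+ (N ^ j) \in val_ring P) ->
  mmap iota x p != 0.
Proof.
move=> pN p0 zP xz.
have z0 : z != 0 by apply: contraNneq zP => ->; rewrite rpred0.
have [|zVM] := val_ring_or_ideal P z0; first by rewrite (negPf zP).
have zVO := val_ideal_sub zVM.
have zVX d : (0 < d)%N -> z^-1 ^+ d \in val_ideal P.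
  by case: d => // d _; rewrite exprSr val_idealM // rpredX.
pose e j := x j / z ^+ (N ^ j).
have [k0 k0p] : exists k, k \in msupp p.
  have := p0; rewrite -msupp_eq0; case: (msupp p) => // k s _.
  by exists k; exact: mem_head.
have N0 j : (0 < N ^ (j : 'I_n))%N.
  by rewrite expn_gt0 (leq_ltn_trans _ (pN _ k0p j)).
have eU j : e j - 1 \in val_ideal P.
  rewrite (_ : e j - 1 = (x j - z ^+ (N ^ j)) * z^-1 ^+ (N ^ j)).
    by rewrite val_idealM // zVX.
  by rewrite exprVn mulrBl mulfV // expf_neq0.
have monoE k : mmap1 x k = mmap1 e k * z ^+ weight N k.
  rewrite /mmap1 /weight -prodrXr -big_split /=; apply: eq_bigr => j _.
  by rewrite mulnC exprM -exprMn divfK // expf_neq0.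
have eO k : mmap1 e k \in val_ring P.
  rewrite -(subrK 1 (mmap1 e k)) rpredD ?rpred1 //; apply: val_ideal_sub.
  exact: mmap1_principal_unit.
have [kmax kp kmaxP] : exists2 k, k \in msupp p &
    forall l, l \in msupp p -> (weight N l <= weight N k)%N.
  have : exists d, has (fun k => weight N k == d) (msupp p).
    by exists (weight N k0); apply/hasP; exists k0.
  move/ex_maxnP => /(_ (\max_(k <- msupp p) weight N k)) [|d].
    by move=> d /hasP[k kp /eqP<-]; exact: leq_bigmax_seq.
  move=> /hasP[k kp /eqP<-] kmax; exists k => // l lp.
  by apply: kmax; apply/hasP; exists l.
apply/eqP => px0; case/negP: (one_notin_ideal P).
have ck0 : iota p@_kmax != 0 by rewrite fmorph_eq0 -mcoeff_msupp.
have ckV : (iota p@_kmax)^-1 \in val_ring P by rewrite -fmorphV val_ringK.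
pose W := weight N kmax.
have rest : \sum_(k <- msupp p | k != kmax)
    iota p@_k * mmap1 e k * z^-1 ^+ (W - weight N k) \in val_ideal P.
  rewrite big_seq_cond; apply: val_ideal_sum => k /andP[kp' kk].
  rewrite val_idealM ?rpredM ?val_ringK //; apply: zVX; rewrite subn_gt0.
  rewrite ltn_neqAle kmaxP // andbT; apply: contraNneq kk => wk.
  by apply/eqP; apply: (weight_inj (pN k kp') (pN kmax kp)).
have lead : iota p@_kmax * mmap1 e kmax = - \sum_(k <- msupp p | k != kmax)
    iota p@_k * mmap1 e k * z^-1 ^+ (W - weight N k).
  apply/eqP; rewrite -addr_eq0; apply/eqP.
  rewrite -[RHS](mul0r (z^-1 ^+ W)) -[X in _ = X * _]px0 /mmap.
  rewrite (bigD1_seq kmax) //= ?msupp_uniq //.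
  rewrite mulrDl mulr_suml; congr (_ + _).
    by rewrite monoE mulrA -[RHS]mulrA -exprMn mulfV // expr1n mulr1.
  rewrite big_seq_cond [RHS]big_seq_cond; apply: eq_bigr => k /andP[kp' _].
  rewrite monoE mulrA -[RHS]mulrA; congr (_ * _).
  have le_k := kmaxP k kp'.
  rewrite (_ : z^-1 ^+ W = z^-1 ^+ weight N k * z^-1 ^+ (W - weight N k)).
    by rewrite mulrA -exprMn mulfV // expr1n mul1r.
  by rewrite -exprD subnKC.
have eM : mmap1 e kmax \in val_ideal P.
  rewrite -[mmap1 e kmax](mulKf ck0) val_idealM // lead; exact: val_idealN.
rewrite -[1](subrK (mmap1 e kmax)) val_idealD // -opprB val_idealN //.
exact: mmap1_principal_unit.
Qed.

(** A relation between the x i is used to eliminate x_0 by Nagata's change of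
    variables: x_0 is finite wherever the differences x_j - x_0 ^ (N ^ j) are.
    This replaces the n + 1 elements by n ones finite at the same places. *)
Lemma noether_normalization n (x : 'I_n -> F) :
  exists m (t : 'I_m -> F), alg_independent iota t /\
    forall P, (forall i, x i \in val_ring P) <-> (forall i, t i \in val_ring P).
Proof.
elim: n x => [|n IHn] x.
  exists 0%N, x; split=> // p.
  have -> : p = (p@_0)%:MP.
    apply/mpolyP => k; rewrite (_ : k = 0%MM) ?mcoeffC ?eqxx ?mulr1 //.
    by apply/mnmP => -[].
  by rewrite mmapC => /eqP; rewrite fmorph_eq0 => /eqP->.
have [xind|] := pselect (alg_independent iota x); first by exists n.+1, x.
move=> /existsNP[p /not_implyP[px /eqP p0]].
pose N := msize p; pose z := x ord0.
pose y (i : 'I_n) := x (lift ord0 i) - z ^+ (N ^ lift ord0 i).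
have [m [t [tind yt]]] := IHn y.
have pN k : k \in msupp p -> forall j, (k j < N)%N.
  move=> kp j; apply: leq_ltn_trans (msize_mdeg_lt kp).
  by rewrite mdegE (bigD1 j) //= leq_addr.
exists m, t; split=> // P; rewrite -(yt P); split=> [xO i|yO].
  by rewrite rpredB ?rpredX //; exact: xO.
have zO : z \in val_ring P.
  apply: contraT => zP.
  suff /eqP[] : mmap iota x p != 0 by [].
  apply: nagata_pole pN p0 zP _ => j; have [i ->|->] := unliftP ord0 j.
    exact: yO.
  by rewrite expn0 expr1 subrr rpred0.
move=> j; have [i ->|-> //] := unliftP ord0 j.
by rewrite -(subrK (z ^+ (N ^ lift ord0 i)) (x _)) rpredD ?rpredX //; exact: yO.
Qed.

End Nagata.

(** * Density *)

Section Density.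
Context {K F : fieldType} (iota : {rmorphism K -> F}).
Implicit Types (P Q : zariski_space iota).

(** The constant coefficient c of the minimal polynomial of b over K(t) is, up
    to sign, the norm of b. The ring A consists of the elements of K(t) integral
    over K[t]; it contains the coefficients of this polynomial. *)
Lemma place_over_others m (t : 'I_m -> F) P b :
  (forall i, ~ algebraic (others iota t i) (t i)) ->
  algebraic (genI iota t setT) b ->
  (forall Q, (forall i, t i \in val_ring Q) -> b \in val_ring Q) ->
  (forall i, t i \in val_ring P) -> b \in val_ideal P -> b != 0 ->
  exists i Q, [/\ {subset others iota t i <= val_ring Q}, t i \in val_ring Q &
    b \in val_ideal Q].
Proof.
move=> ttr balg bint tP bM b0; pose L := genI iota t setT.
have KL c : iota c \in L by exact: genI_iota.
have tL i : t i \in L by exact: genI_mem.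
have [f fmin] := exists_minimal_polynomial balg.
pose good z :=
  `[< forall Q, (forall i, t i \in val_ring Q) -> z \in val_ring Q >].
have clA : subring_closed [pred z | (z \in L) && good z].
  split=> [|x y /andP[xL /asboolP xA] /andP[yL /asboolP yA]
           |x y /andP[xL /asboolP xA] /andP[yL /asboolP yA]]; apply/andP.
  - by split; [exact: rpred1|apply/asboolP => Q _; exact: rpred1].
  - split; first exact: rpredB.
    by apply/asboolP => Q tQ; rewrite rpredB ?xA ?yA.
  - split; first exact: rpredM.
    by apply/asboolP => Q tQ; rewrite rpredM ?xA ?yA.
pose A := subring_of clA.
have KA c : iota c \in A.
  by apply/andP; split=> //; apply/asboolP => Q _; exact: val_ringK.
have tA i : t i \in A by apply/andP; split=> //; apply/asboolP => Q; apply.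
have AL : {subset A <= L} by move=> z /andP[].
have AQ Q : (forall i, t i \in val_ring Q) -> {subset A <= val_ring Q}.
  by move=> tQ z /andP[_ /asboolP]; apply.
have fO Q : (forall i, t i \in val_ring Q) -> f \is a polyOver (val_ring Q).
  move=> tQ; apply: minimal_polynomial_integral KA AL _ fmin _ (AQ Q tQ).
  by move=> R AR; apply: bint => i; exact/AR/tA.
have [fm /polyOverP fL fb _] := fmin.
have c0 : f`_0 != 0 by exact: minimal_polynomial_coef0 fmin b0.
have cM : f`_0 \in val_ideal P.
  exact: minimal_polynomial_coef0_ideal (fO P tP) fb bM.
have cK k : f`_0 != iota k.
  by apply/eqP => ck; have := val_idealV c0 cM; rewrite ck -fmorphV val_ringK.
have [i ctr] := exists_transcendental_over_others ttr (fL 0%N) cK.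
have cE : f`_0 \in fractions (adjoin (others iota t i) (t i)).
  apply: genI_adjoin (fL 0%N) => j _ /=.
  by have [->|] := eqVneq j i; [left|right].
have [R [ER tiR cR]] := finite_zero_or_pole (genI_iota iota t _) ctr cE.
have tR j : t j \in val_ring R.
  by have [->//|ji] := eqVneq j i; apply: ER; exact: genI_mem.
have cO : f`_0 \in val_ring R by have /polyOverP := fO R tR; apply.
have {}cR : f`_0 \in val_ideal R.
  case: cR => // cVM; have := val_idealV _ cVM.
  by rewrite invr_eq0 invrK cO => /(_ c0).
have [Q [RQ bQ]] := lift_place KL b0 fmin (fO R tR) cR.
exists i, Q; split=> //; last exact: RQ.
by move=> x xE; apply: RQ; [exact: genI_mono _ _ xE|exact: ER].
Qed.

(** The second equation carries information when b is 0: all elements of bs are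
    then 0. *)
Lemma common_divisor P (bs : seq F) : {subset bs <= val_ideal P} ->
  exists2 b, b \in val_ideal P &
    forall x, x \in bs -> x / b \in val_ring P /\ x = x / b * b.
Proof.
move=> bsM; have [|bs0] := boolP (has (fun x => x != 0) bs).
  move=> /(dominant_elt P)[b [bb b0 bdom]]; exists b; first exact: bsM.
  by move=> x xb; rewrite divfK // bdom.
exists 0 => [|x xb]; first exact: val_ideal0.
by move/hasPn/(_ _ xb): bs0; rewrite negbK => /eqP->; rewrite !mul0r rpred0.
Qed.

(** Each generator of F or its inverse lies in O_P. *)
Lemma finitely_generated_model P : finitely_generated iota ->
  exists s : seq F, {subset s <= val_ring P} /\
    forall E : divringClosed F, (forall c, iota c \in E) ->
      (forall x, x \in s -> algebraic E x) -> forall y, algebraic E y.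
Proof.
move=> [n [g gF]].
pose h i := if g i \in val_ring P then g i else (g i)^-1.
exists [seq h i | i <- enum 'I_n]; split=> [_ /mapP[i _ ->]|E KE sE y].
  rewrite /h; case: ifP => // /negbT giO.
  have gi0 : g i != 0 by apply: contraNneq giO => ->; rewrite rpred0.
  have [|/val_ideal_sub//] := val_ring_or_ideal P gi0.
  by rewrite (negPf giO).
have yg : y \in gen iota (range g) by apply: mem_set; rewrite gF.
apply/asboolP; apply: (gen_sub (algebraic_closed KE) _ _ yg)
  => [c|_ [i _ <-]]; apply/asboolP.
  exact: algebraic_mem.
have : algebraic E (h i) by apply: sE; apply: map_f; rewrite mem_enum.
by rewrite /h; case: ifP => // _ /(algebraicV KE); rewrite invrK.
Qed.

Lemma prime_divisor_patch P (a bs : seq F) : algebraic_function_field iota ->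
  patch_basic a bs P -> exists Q, prime_divisor Q /\ patch_basic a bs Q.
Proof.
move=> [Ffg [d d0 [x [xind _]]]] [aP bP].
have [b bM bdiv] := common_divisor bP.
have [s [sP sgen]] := finitely_generated_model P Ffg.
pose xs := b :: a ++ [seq y / b | y <- bs] ++ s.
have xsP : {subset xs <= val_ring P}.
  move=> y; rewrite inE !mem_cat.
  move=> /predU1P[->|/or3P[/aP//|/mapP[z zb ->]|/sP//]].
    exact: val_ideal_sub.
  by case: (bdiv z zb).
have [m [t [tind tval]]] := noether_normalization iota (tnth (in_tuple xs)).
have xsQ Q : (forall i, t i \in val_ring Q) -> {subset xs <= val_ring Q}.
  by move/tval => xQ y /seq_tnthP[i ->].
have tP i : t i \in val_ring P.
  by apply: (tval P).1 => j; apply: xsP; exact: mem_tnth.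
have Falg y : algebraic (genI iota t setT) y.
  have KL c : iota c \in genI iota t setT by exact: genI_iota.
  apply: sgen => // z zs; apply/(algebraicP _ KL) => Q LQ.
  apply: xsQ; last by rewrite inE !mem_cat zs !orbT.
  by move=> i; apply: LQ; exact: genI_mem.
have ttr i := alg_independent_transcendental (i := i) tind.
case: m => [|m] in t tind tval xsQ tP Falg ttr *.
  (* Without variables F would be algebraic over K. *)
  pose i0 : 'I_d := Ordinal d0.
  case: (alg_independent_transcendental (i := i0) xind).
  apply: algebraicS (Falg (x i0)); apply: gen_sub => [|c|_ [[]//]].
    exact: gen_closed.
  exact: genI_iota.
suff [i [Q [EQ tiQ bQ [b' b'0 b'Q]]]] : exists i Q,
    [/\ {subset others iota t i <= val_ring Q}, t i \in val_ring Q,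
        b \in val_ideal Q & exists2 b', b' != 0 & b' \in val_ideal Q].
  exists Q; split.
    exists m; split; first by exists t.
    by have := residue_trdeg tind Falg EQ b'0 b'Q.
  have {}xsQ : {subset xs <= val_ring Q}.
    apply: xsQ => j; have [->//|ji] := eqVneq j i.
    by apply: EQ; exact: genI_mem.
  split=> y ys; first by apply: xsQ; rewrite inE !mem_cat ys !orbT.
  have [_ ->] := bdiv y ys; apply: val_idealM => //; apply: xsQ.
  have yb : y / b \in [seq z / b | z <- bs] by apply/mapP; exists y.
  by rewrite inE !mem_cat yb !orbT.
have [b0|b0] := eqVneq b 0; last first.
  have [|i [Q [EQ tiQ bQ]]] := place_over_others ttr (Falg b) _ tP bM b0.
    by move=> Q tQ; apply: (xsQ Q tQ); exact: mem_head.
  by exists i, Q; split=> //; exists b.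
have [Q [EQ tQ]] := place_of_transcendental (genI_iota iota t _) (ttr ord0).
exists ord0, Q; split; [by []|exact: val_ideal_sub|by rewrite b0 val_ideal0|].
exists (t ord0) => //; apply: contra_not_neq (ttr ord0) => ->.
by apply: algebraic_mem; exact: rpred0.
Qed.

End Density.

Theorem corollary4 (K F : fieldType) (iota : {rmorphism K -> F})
  (hF : algebraic_function_field iota) :
  dense [set P : zariski_space iota | prime_divisor P].
Proof.
move=> U [P UP] [D Dbase UE]; rewrite -UE in UP *.
have [V DV PV] := UP; have [a [b VE]] := Dbase _ DV.
rewrite VE in PV; have [Q [Qdiv Qab]] := prime_divisor_patch hF PV.
by exists Q; split=> //; exists V => //; rewrite VE.
Qed.
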